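(* There exist $c,\kappa>0$ such that for all $f_0\in H^1(d\mu d\nu)$ with $\langle f_0\rangle=0$, the solution $f$ of $$\partial_tf+v\,\partial_xf+(-\partial_v+v)\partial_vf=0,\qquad f|_{t=0}=f_0,$$ on $\mathbb{T}\times\mathbb{R}$ satisfies $$\|f(t)\|_{H^1}\le c\,e^{-\kappa t}\|f_0\|_{H^1}\qquad\text{for all }t\ge0 .$$
   Context: $\mathbb{T}$ is the one-dimensional torus, $d\mu$ the normalized (probability) Lebesgue measure on $\mathbb{T}$, $d\nu=(2\pi)^{-1/2}e^{-v^2/2}dv$, and $\langle f_0\rangle=\iint f_0\,d\mu d\nu$. With $\|\cdot\|$ the norm of $L^2(d\mu d\nu)$, $H^1(d\mu d\nu)$ is the space of $f\in L^2(d\mu d\nu)$ with $\partial_xf,\partial_vf\in L^2(d\mu d\nu)$, with norm $\|f\|_{H^1}^2=\|f\|^2+\|\partial_xf\|^2+\|\partial_vf\|^2$. Solutions: let $P=v\partial_x+(-\partial_v+v)\partial_v$, equipped with an appropriate domain (for instance its closure from $C_c^\infty(\mathbb{T}\times\mathbb{R})$) to which the Hille–Yosida theorem applies; the solution is $f(t)=e^{-tP}f_0$. It is a standing assumption that the equation is likewise well posed in $H^1(d\mu d\nu)$. *)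

(* Defs.v *)
From HB Require Import structures.
From mathcomp Require Import all_boot all_order all_algebra.
From mathcomp Require Import all_classical all_reals all_analysis.
Import Order.TTheory GRing.Theory Num.Theory.
Import numFieldNormedType.Exports.

Set Implicit Arguments.
Unset Strict Implicit.
Unset Printing Implicit Defensive.

Local Open Scope classical_set_scope.
Local Open Scope ring_scope.

Section KineticFokkerPlanck.
Context {R : realType}.
(* The torus is R/LZ.  Its fundamental domain [0, L[ carries the measures, and
   periodicity is imposed on the test functions; an element of L^2 is given by
   a representative R * R -> R, whose values outside the strip are irrelevant. *)
Variables (L : R) (L_gt0 : 0 < L).

Definition phase_measure := (uniform_prob L_gt0 \x normal_prob (0 : R) 1)%E.

Definition mean (f : R * R -> R) : R := \int[phase_measure]_z f z.

Definition L2 : set (R * R -> R) :=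
  [set f | f \in Lfun phase_measure 2%:E].

Definition L2norm (f : R * R -> R) : R :=
  fine ('N[phase_measure]_(2%:E)[EFin \o f])%E.

Definition dx (f : R * R -> R) : R * R -> R := fun z => 'D_(1, 0) f z.
Definition dv (f : R * R -> R) : R * R -> R := fun z => 'D_(0, 1) f z.

Definition FP (f : R * R -> R) : R * R -> R :=
  fun z => z.2 * dx f z + (- dv (dv f) z + z.2 * dv f z).

Definition smooth (f : R * R -> R) : Prop :=
  forall (w : seq bool) (z : R * R),
    differentiable (foldr (fun b => if b then dx else dv) f w) z.

(* C_c^oo(T x R) *)
Definition test_function (phi : R * R -> R) : Prop :=
  [/\ smooth phi,
      forall x v, phi (x + L, v) = phi (x, v) &
      exists M, forall x v, M < `|v| -> phi (x, v) = 0].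

(* g is the derivative of f in the sense of distributions on T x R, where D is
   dx or dv. *)
Definition weak_derivative (D : (R * R -> R) -> R * R -> R)
    (f g : R * R -> R) : Prop :=
  forall phi, test_function phi ->
    \int[(lebesgue_measure \x lebesgue_measure)%E]_(z in `[0, L[ `*` setT)
      (f z * D phi z) =
    - \int[(lebesgue_measure \x lebesgue_measure)%E]_(z in `[0, L[ `*` setT)
      (g z * phi z).

Definition L2_derivatives D (f : R * R -> R) : set (R * R -> R) :=
  [set g | L2 g /\ weak_derivative D f g].

Definition H1 : set (R * R -> R) :=
  [set f | [/\ L2 f, L2_derivatives dx f !=set0 & L2_derivatives dv f !=set0]].

(* The choice of a representative of the derivative is immaterial. *)
Definition weak_d D (f : R * R -> R) : R * R -> R :=
  xget (cst 0) (L2_derivatives D f).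

Definition H1norm (f : R * R -> R) : R :=
  Num.sqrt (L2norm f ^+ 2 + L2norm (weak_d dx f) ^+ 2
            + L2norm (weak_d dv f) ^+ 2).

(* In what follows a Banach space of classes of functions is given by the set X
   of representatives of its elements and by its norm N, a seminorm on X;
   equality in that space is N (f - g) = 0. *)

(* The graph of the closure in X of FP restricted to C_c^oo(T x R). *)
Definition FP_closure (X : set (R * R -> R)) (N : (R * R -> R) -> R)
    (f g : R * R -> R) : Prop :=
  [/\ X f, X g &
    exists phi : nat -> R * R -> R,
      [/\ forall n, test_function (phi n),
          N (phi n \- f) @[n --> \oo] --> (0 : R) &
          N (FP (phi n) \- g) @[n --> \oo] --> (0 : R)]].

Record C0_semigroup (X : set (R * R -> R)) (N : (R * R -> R) -> R)
    (S : R -> (R * R -> R) -> R * R -> R) : Prop := {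
  semigroup_stable : forall t f, 0 <= t -> X f -> X (S t f);
  semigroup_linear : forall t (a : R) f g, 0 <= t -> X f -> X g ->
    N (S t (fun z => a * f z + g z) \- (fun z => a * S t f z + S t g z)) = 0;
  semigroup_bounded : forall t, 0 <= t ->
    exists M : R, forall f, X f -> N (S t f) <= M * N f;
  semigroup_0 : forall f, X f -> N (S 0 f \- f) = 0;
  semigroup_D : forall s t f, 0 <= s -> 0 <= t -> X f ->
    N (S (s + t) f \- S s (S t f)) = 0;
  semigroup_cvg0 : forall f, X f -> N (S t f \- f) @[t --> 0^'+] --> (0 : R)
}.

Definition generator X N (S : R -> (R * R -> R) -> R * R -> R)
    (f g : R * R -> R) : Prop :=
  [/\ X f, X g &
    N (fun z => h^-1 * (S h f z - f z) - g z) @[h --> 0^'+] --> (0 : R)].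

(* S t is exp(- t P), where P is the closure in X of FP on C_c^oo(T x R), a
   densely defined operator as in the Hille-Yosida theorem (in a Banach space,
   density also follows from the two other fields). *)
Record FP_semigroup (X : set (R * R -> R)) (N : (R * R -> R) -> R)
    (S : R -> (R * R -> R) -> R * R -> R) : Prop := {
  FP_semigroup_C0 : C0_semigroup X N S;
  FP_semigroup_dense : forall f (e : R), X f -> 0 < e ->
    exists2 phi, test_function phi & N (phi \- f) < e;
  FP_semigroup_generator : forall f g,
    generator X N S f g <-> FP_closure X N f (fun z => - g z)
}.

End KineticFokkerPlanck.

(* Main.v *)
(* The modified energy
     E(f) = 10 (|f|^2 - <f>^2) + |d_v f|^2 + |d_x f + d_v f|^2
   is equivalent to |f|_{H^1}^2 on functions of mean zero.  Since
   [d_v, v d_x] = d_x, its mixed term produces the missing dissipation in x, and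
   integrations by parts give E(f, P f) >= (|d_x f|^2 + |d_v f|^2) / 2 on test
   functions; by the Poincare inequality of dmu dnu this is at least kappa E(f).
   So E decays like e^{-2 kappa t} along the H^1 semigroup started from a test
   function, and by density from any element of H^1, while the mean is conserved
   because <P f> = 0.  On test functions the H^1 and the L^2 semigroups solve the
   same equation in L^2, where <f, P f> >= 0 makes solutions unique; by density
   they agree on H^1, and the decay passes to the L^2 semigroup. *)
From HB Require Import structures.
Require Import Defs.
From mathcomp Require Import all_boot all_order all_algebra.
From mathcomp Require Import all_classical all_reals all_analysis.
From mathcomp Require Import measurable_realfun ring lra.
Import Order.TTheory GRing.Theory Num.Theory.
Import numFieldNormedType.Exports.

Set Implicit Arguments.
Unset Strict Implicit.
Unset Printing Implicit Defensive.

Local Open Scope classical_set_scope.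
Local Open Scope ring_scope.

(** Subtracting <f>^2 in the energy makes coercivity hold for every test function, so that density
    needs no approximation by functions of mean zero. The commutator [d_v, P] = d_x + d_v
    contributes |d_x f|^2 + 3 <d_x f, d_v f> + 2 |d_v f|^2; the coefficient 10 of |f|^2, which
    dissipates 10 |d_v f|^2, is there to absorb the cross term. Functions are representatives, not
    classes. A chosen weak derivative is linear only up to null functions, whereas a bilinear form
    built from it is exactly linear; estimates are therefore stated for forms on sets of
    representatives. Density of test functions in L^2, part of the hypothesis on the L^2 semigroup,
    makes weak derivatives unique. A semigroup readily gives right derivatives, and a bound at each
    separate time; the left continuity that the Gronwall argument also needs rests on bounds that
    are uniform near a given time. The Poincare inequality goes through deviations from values at 0
    rather than from means: any reference constant bounds a variance, and vanishing at a point gives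
    the boundary terms a sign. *)

Section RightDerivative.
Context {R : realType}.
Implicit Types p q : R -> R.

(** Continuity induction: for a slope [e] > 0, left continuity keeps the bound [p s <= p 0 + e * s]
    at the supremum of the times up to which it holds, and the growth condition on the right carries
    it past that supremum. Then [e] tends to 0. *)
Lemma right_nonincreasing p :
  (forall t : R, 0 < t -> p (t - h) @[h --> 0^'+] --> p t) ->
  (forall t e : R, 0 <= t -> 0 < e ->
    \forall h \near 0^'+, p (t + h) <= p t + e * h) ->
  forall t : R, 0 <= t -> p t <= p 0.
Proof.
move=> pl pr T T0.
have main (e : R) : 0 < e -> p T <= p 0 + e * T.
  move=> e0.
  pose A := [set t : R | 0 <= t <= T /\ forall s : R, 0 <= s <= t -> p s <= p 0 + e * s].
  have A0 : A 0.
    split; first by rewrite lexx.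
    by move=> s /andP[s0 s1]; rewrite (_ : s = 0) ?mulr0 ?addr0//; lra.
  have ubA : has_ubound A by exists T => t [/andP[]].
  have supA : has_sup A by split=> //; exists 0.
  set tau := sup A.
  have tau0 : 0 <= tau by exact: ub_le_sup.
  have tauT : tau <= T by apply: ge_sup => //; [exists 0|move=> t [/andP[]]].
  have lt_tau (s : R) : 0 <= s < tau -> p s <= p 0 + e * s.
    move=> /andP[s0 st].
    have [t At] := sup_adherent (eps := tau - s) (ltac:(by rewrite subr_gt0)) supA.
    rewrite -/tau subKr => st'; case: At => _; apply.
    by rewrite s0 ltW.
  have p_tau : p tau <= p 0 + e * tau.
    move: tau0; rewrite le_eqVlt => /predU1P[<-|tau_gt0].
      by rewrite mulr0 addr0.
    have cv := pl _ tau_gt0.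
    have cv2 : p 0 + e * (tau - h) @[h --> 0^'+] --> p 0 + e * tau.
      have {2}-> : tau = tau - 0 by rewrite subr0.
      apply: cvgD; first exact: cvg_cst.
      apply: cvgM; first exact: cvg_cst.
      apply: cvgB; first exact: cvg_cst.
      by apply: cvg_at_right_filter; exact: cvg_id.
    apply: (ler_cvg_to cv cv2).
    near=> h; apply: lt_tau; rewrite subr_ge0 ltrBlDr ltrDl.
    by apply/andP; split; near: h; [exact: nbhs_right_le|exact: nbhs_right_gt].
  have Atau (s : R) : 0 <= s <= tau -> p s <= p 0 + e * s.
    rewrite [X in _ && X]le_eqVlt => /andP[s0 /predU1P[->//|st]].
    by apply: lt_tau; rewrite s0.
  move: tauT; rewrite le_eqVlt => /predU1P[<-//|tauT].
  have /(pr _ _ tau0)[d /= d0 Hd] := e0.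
  pose h := Num.min (d / 2) (T - tau).
  have h0 : 0 < h by rewrite lt_min divr_gt0//= subr_gt0.
  suff : A (tau + h).
    by move=> /(ub_le_sup ubA); rewrite -/tau leNgt ltrDl h0.
  split; first by rewrite addr_ge0 ?(ltW h0)//= -lerBrDl ge_min lexx orbT.
  move=> s /andP[s0 sh]; have [st|ts] := leP s tau.
    by apply: Atau; rewrite s0.
  have := Hd (s - tau); rewrite subrKC => /(_ _ _)/le_trans; apply.
  - rewrite /= sub0r normrN gtr0_norm ?subr_gt0// ltrBlDl (le_lt_trans sh)//.
    by rewrite ltrD2l /h gt_min ltr_pdivrMr// mulr_natr mulr2n ltrDl d0.
  - by rewrite subr_gt0.
  - by rewrite mulrBr; lra.
apply/ler_addgt0Pr => e e0.
(* Dividing by T + 1 instead of T covers T = 0. *)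
have T1 : 0 < T + 1 by lra.
apply: (le_trans (main (e / (T + 1)) _)); first by rewrite divr_gt0.
by rewrite lerD2l mulrAC ler_pdivrMr// ler_pM2l//; lra.
Unshelve. all: by end_near. Qed.

(** The integrating factor exp(k t) gives the product [p] a nonpositive right derivative. *)
Lemma right_gronwall q (k : R) :
  (forall t : R, 0 < t -> q (t - h) @[h --> 0^'+] --> q t) ->
  (forall t : R, 0 <= t -> exists2 l : R, l <= - k * q t &
    h^-1 * (q (t + h) - q t) @[h --> 0^'+] --> l) ->
  forall t : R, 0 <= t -> q t <= expR (- k * t) * q 0.
Proof.
move=> ql qr t t0.
pose p s := expR (k * s) * q s.
suff: p t <= p 0.
  rewrite /p mulr0 expR0 mul1r => H.
  by rewrite mulNr expRN (mulrC _ (q 0)) ler_pdivlMr ?expR_gt0// mulrC.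
(* Used with c = -1 for the left continuity of [p] and with c = 1 for its right derivative. *)
have cexp (s c : R) : expR (k * (s + c * h)) @[h --> 0^'+] --> expR (k * s).
  have {2}-> : s = s + c * 0 by rewrite mulr0 addr0.
  apply: cvg_comp; last exact: continuous_expR.
  apply: cvgM; first exact: cvg_cst.
  apply: cvgD; first exact: cvg_cst.
  apply: cvgM; first exact: cvg_cst.
  by apply: cvg_at_right_filter; exact: cvg_id.
apply: right_nonincreasing t0 => {t}.
  move=> t t0; apply: cvgM; last exact: ql.
  under eq_fun do rewrite -mulN1r.
  exact: cexp.
move=> t e t0 e0.
have [l lk hl] := qr t t0.
have dexp : h^-1 * (expR (k * (t + h)) - expR (k * t)) @[h --> 0^'+]
    --> k * expR (k * t).
  have : is_derive t 1 (fun x => expR (k * x)) (k * expR (k * t)).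
    have D : is_derive t 1 (fun x : R => k * x) k.
      by apply: (is_derive_eq (is_deriveZ k (is_derive_id t 1))); exact: mulr1.
    rewrite [X in is_derive _ _ _ X]mulrC.
    exact: is_derive1_comp (is_derive_expR _) D.
  case=> + <- => /cvg_dnbhs_at_right.
  apply: cvg_trans; rewrite (_ : (fun h => h^-1 * _) = (fun h => h^-1 *:
      (((fun x => expR (k * x)) \o shift t) (h *: 1) - expR (k * t))))//.
  by apply/funext => h /=; rewrite /GRing.scale/= mulr1 (addrC h).
have cvp : h^-1 * (p (t + h) - p t) @[h --> 0^'+]
    --> expR (k * t) * l + q t * (k * expR (k * t)).
  rewrite (_ : (fun h => _) = (fun h => expR (k * (t + 1 * h)) *
      (h^-1 * (q (t + h) - q t)) +
      q t * (h^-1 * (expR (k * (t + h)) - expR (k * t))))).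
    apply: cvgD; first by apply: cvgM => //; exact: cexp.
    by apply: cvgM => //; exact: cvg_cst.
  by apply/funext => h; rewrite mul1r /p; ring.
have lt_e : expR (k * t) * l + q t * (k * expR (k * t)) < e.
  apply: le_lt_trans e0.
  rewrite [q t * _](_ : _ = expR (k * t) * (k * q t)); last by ring.
  rewrite -mulrDr pmulr_rle0 ?expR_gt0//.
  by rewrite -[leRHS](addNr (k * q t)) lerD2r -mulNr.
have := cvgr_lt _ cvp _ lt_e.
move=> near_lt; near=> h.
have h0 : 0 < h by near: h; exact: nbhs_right_gt.
rewrite -lerBlDl -ler_pdivrMr// mulrC.
by apply: ltW; near: h; exact: near_lt.
Unshelve. all: by end_near. Qed.

End RightDerivative.

(** * Positive semidefinite forms on sets of representatives *)

Section SemiInnerProduct.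
Context {R : realType}.
Local Notation V := (R * R -> R).

Definition lin (a : R) (f g : V) : V := fun z => a * f z + g z.

Definition lin_closed (X : set V) :=
  forall a f g, X f -> X g -> X (lin a f g).

(** Linearity refers to pointwise combinations of representatives, and definiteness is not asked
    for, since a null function need not vanish. Such a form can be linear even when the operation on
    functions behind it is so only up to null functions. *)
Record semi_inner (X : set V) (Q : V -> V -> R) : Prop := {
  si_sym : forall f g, X f -> X g -> Q f g = Q g f;
  si_lin : forall a f g h, X f -> X g -> X h ->
    Q (lin a f g) h = a * Q f h + Q g h;
  si_ge0 : forall f, X f -> 0 <= Q f f }.

Lemma sub_lin (f g : V) : f \- g = lin (-1) g f.
Proof. by apply/funext => z /=; rewrite /lin mulN1r addrC. Qed.

Context {X : set V} (linX : lin_closed X).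

Lemma sub_closed f g : X f -> X g -> X (f \- g).
Proof. by move=> Xf Xg; rewrite sub_lin; exact: linX. Qed.

Definition snorm (Q : V -> V -> R) f := Num.sqrt (Q f f).

Section Form.
Context {Q : V -> V -> R} (siQ : semi_inner X Q).

Lemma si_subl f g h : X f -> X g -> X h -> Q (f \- g) h = Q f h - Q g h.
Proof. by move=> *; rewrite sub_lin (si_lin siQ)//; ring. Qed.

Lemma si_linr a f g h : X f -> X g -> X h ->
  Q h (lin a f g) = a * Q h f + Q h g.
Proof.
move=> Xf Xg Xh; rewrite (si_sym siQ)//; last exact: linX.
by rewrite (si_lin siQ)// ![Q _ h](si_sym siQ).
Qed.

Lemma si_subr f g h : X f -> X g -> X h -> Q h (f \- g) = Q h f - Q h g.
Proof. by move=> *; rewrite sub_lin si_linr//; ring. Qed.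

Lemma si_sqr_lin a f g : X f -> X g ->
  Q (lin a f g) (lin a f g) = a ^+ 2 * Q f f + a * Q f g *+ 2 + Q g g.
Proof.
move=> Xf Xg; have Xl : X (lin a f g) by exact: linX.
by rewrite (si_lin siQ)// !si_linr// (si_sym siQ Xg Xf); ring.
Qed.

Lemma cauchy_schwarz f g : X f -> X g -> Q f g ^+ 2 <= Q f f * Q g g.
Proof.
move=> Xf Xg.
have H a : 0 <= a ^+ 2 * Q f f + a * Q f g *+ 2 + Q g g.
  by rewrite -si_sqr_lin//; apply: (si_ge0 siQ); exact: linX.
have := si_ge0 siQ Xf; rewrite le_eqVlt => /predU1P[f0|f_gt0].
  rewrite -f0 mul0r; have [->|b0] := eqVneq (Q f g) 0; first by rewrite expr0n.
  (* When [Q f f] = 0 the quadratic is affine in [a], and this choice gives it the value -1. *)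
  have := H (- (Q g g + 1) / (2 * Q f g)).
  by rewrite -f0 (_ : _ + Q g g = -1); [lra|field].
(* The minimiser of the quadratic in [a]. *)
have := H (- Q f g / Q f f).
have -> : (- Q f g / Q f f) ^+ 2 * Q f f + - Q f g / Q f f * Q f g *+ 2 + Q g g
  = (Q f f * Q g g - Q f g ^+ 2) / Q f f by field; rewrite gt_eqF.
by rewrite pmulr_lge0 ?invr_gt0// subr_ge0.
Qed.

Lemma le_snorm f g : X f -> X g -> `|Q f g| <= snorm Q f * snorm Q g.
Proof.
move=> Xf Xg; rewrite -sqrtrM ?(si_ge0 siQ)// -sqrtr_sqr ler_sqrt.
  exact: cauchy_schwarz.
by rewrite mulr_ge0 ?(si_ge0 siQ).
Qed.

Lemma snorm_lin a f g : X f -> X g ->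
  snorm Q (lin a f g) <= `|a| * snorm Q f + snorm Q g.
Proof.
move=> Xf Xg.
rewrite -(@ger0_norm _ (_ + snorm Q g)) ?addr_ge0 ?mulr_ge0 ?sqrtr_ge0//.
rewrite -sqrtr_sqr ler_sqrt ?sqr_ge0//.
rewrite si_sqr_lin// sqrrD exprMn sqr_sqrtr ?(si_ge0 siQ)//.
rewrite sqr_sqrtr ?(si_ge0 siQ)// real_normK ?num_real// lerD2r lerD2l.
rewrite lerMn2r /= (le_trans (ler_norm _))// normrM -mulrA.
by rewrite ler_wpM2l// le_snorm.
Qed.

End Form.
End SemiInnerProduct.

Section Seminorm.
Context {R : realType}.
Local Notation V := (R * R -> R).
Context {X : set V} (linX : lin_closed X).
Context {B : V -> V -> R} (siB : semi_inner X B).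
Context {N : V -> R} (NE : forall f, X f -> N f = snorm B f).

Lemma N_ge0 f : X f -> 0 <= N f.
Proof. by move=> Xf; rewrite NE// sqrtr_ge0. Qed.

Lemma N_lin a f g : X f -> X g -> N (lin a f g) <= `|a| * N f + N g.
Proof. by move=> Xf Xg; have Xl := linX a Xf Xg; rewrite !NE//; exact: (snorm_lin linX siB). Qed.

Lemma N_triangle f g h : X f -> X g -> X h ->
  N (f \- h) <= N (f \- g) + N (g \- h).
Proof.
move=> Xf Xg Xh; rewrite (_ : f \- h = lin 1 (f \- g) (g \- h)).
  have := N_lin 1 (sub_closed linX Xf Xg) (sub_closed linX Xg Xh).
  by rewrite normr1 mul1r.
by apply/funext => z; rewrite /lin /=; ring.
Qed.

Lemma N_subC f g : X f -> X g -> N (f \- g) = N (g \- f).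
Proof.
move=> Xf Xg; have Xfg := sub_closed linX Xf Xg.
have Xgf := sub_closed linX Xg Xf.
rewrite !NE// /snorm !(si_subr linX siB)// !(si_subl siB)//.
by congr Num.sqrt; ring.
Qed.

Lemma N_le_sub f g : X f -> X g -> N f <= N (f \- g) + N g.
Proof.
move=> Xf Xg; rewrite {1}(_ : f = lin 1 (f \- g) g).
  by have := N_lin 1 (sub_closed linX Xf Xg) Xg; rewrite normr1 mul1r.
by apply/funext => z; rewrite /lin /=; ring.
Qed.

Section BoundedForm.
Context {Q : V -> V -> R} (siQ : semi_inner X Q).
Context {C : R} (QN : forall f, X f -> snorm Q f <= C * N f).

Lemma bounded_form f g : X f -> X g -> `|Q f g| <= C ^+ 2 * (N f * N g).
Proof.
move=> Xf Xg; apply: le_trans (le_snorm linX siQ Xf Xg) _.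
apply: le_trans (ler_pM _ _ (QN Xf) (QN Xg)) _; rewrite ?sqrtr_ge0//.
by rewrite expr2 mulrACA.
Qed.

(** The bound by [N] makes [Q] jointly continuous: the error is Q(u - f, w - g) + Q(u - f, g) + Q(f,
    w - g), and [e] dominates it term by term. Membership in [X] is asked only eventually, because a
    time such as t - h is nonnegative only for small h. *)
Lemma si_cvg (T : Type) (F : set_system T) {FF : Filter F} (u w : T -> V) f g :
  (\forall i \near F, X (u i)) -> (\forall i \near F, X (w i)) ->
  X f -> X g ->
  N (u i \- f) @[i --> F] --> (0 : R) -> N (w i \- g) @[i --> F] --> (0 : R) ->
  Q (u i) (w i) @[i --> F] --> Q f g.
Proof.
move=> Xu Xw Xf Xg uf wg.
pose e i := C ^+ 2 * (N (u i \- f) * N (w i \- g)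
  + N (u i \- f) * N g + N f * N (w i \- g)).
have e0 : e i @[i --> F] --> (0 : R).
  have -> : 0 = C ^+ 2 * (0 * 0 + 0 * N g + N f * 0) :> R.
    by rewrite !mulr0 !mul0r !addr0 mulr0.
  apply: cvgM; first exact: cvg_cst.
  apply: cvgD; last by apply: cvgM => //; exact: cvg_cst.
  by apply: cvgD; apply: cvgM => //; exact: cvg_cst.
apply/cvgrPdist_le => d d0; near=> i; rewrite distrC.
apply: (@le_trans _ _ (e i)); last first.
  by near: i; exact: cvgr_le e0 _ d0.
have Xui : X (u i) by near: i.
have Xwi : X (w i) by near: i.
have Xuf := sub_closed linX Xui Xf.
have Xwg := sub_closed linX Xwi Xg.
have -> : Q (u i) (w i) - Q f g =
    Q (u i \- f) (w i \- g) + Q (u i \- f) g + Q f (w i \- g).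
  by rewrite !(si_subr linX siQ)// !(si_subl siQ)//; ring.
rewrite /e !mulrDr (le_trans (ler_normD _ _))// lerD ?bounded_form//.
by rewrite (le_trans (ler_normD _ _))// lerD ?bounded_form.
Unshelve. all: by end_near. Qed.

End BoundedForm.
End Seminorm.

(** * Continuity in time of a strongly continuous semigroup *)

Section C0Semigroup.
Context {R : realType}.
Local Notation V := (R * R -> R).
Context {X : set V} (linX : lin_closed X).
Context {B : V -> V -> R} (siB : semi_inner X B).
Context {N : V -> R} (NE : forall f, X f -> N f = snorm B f).
Context {S : R -> V -> V} (C0 : C0_semigroup X N S).

Let XS (t : R) f : 0 <= t -> X f -> X (S t f) := @semigroup_stable _ _ _ _ C0 t f.
Let Xsub := sub_closed linX.
Let Nsub := N_le_sub linX siB NE.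
Let Nge0 := N_ge0 NE.
Let Ntri := N_triangle linX siB NE.
Let NC := N_subC linX siB NE.

Lemma N_eq f g : X f -> X g -> N (f \- g) = 0 -> N f = N g.
Proof.
move=> Xf Xg fg0; apply/eqP; rewrite eq_le.
rewrite (le_trans (Nsub Xf Xg)) ?fg0 ?add0r//.
by rewrite (le_trans (Nsub Xg Xf))// -NC// fg0 add0r.
Qed.

Lemma semigroup_subE (t : R) f g : 0 <= t -> X f -> X g ->
  N (S t f \- S t g) = N (S t (f \- g)).
Proof.
move=> t0 Xf Xg; have Xfg := Xsub Xf Xg; apply/esym/N_eq; first exact: XS.
  by apply: Xsub; exact: XS.
by rewrite !sub_lin; have := semigroup_linear C0 (-1) t0 Xg Xf; rewrite sub_lin.
Qed.

Lemma semigroup_addE (s t : R) f : 0 <= s -> 0 <= t -> X f ->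
  N (S (s + t) f) = N (S s (S t f)).
Proof.
move=> s0 t0 Xf; apply: N_eq; [exact: XS (addr_ge0 _ _) _|exact/XS/XS|].
exact: (semigroup_D C0).
Qed.

Lemma semigroup_right_continuous (t : R) f : 0 <= t -> X f ->
  N (S (t + h) f \- S t f) @[h --> 0^'+] --> (0 : R).
Proof.
move=> t0 Xf; have [M MP] := semigroup_bounded C0 t0.
have e0 : M * N (S h f \- f) @[h --> 0^'+] --> (0 : R).
  rewrite -[X in _ --> X](mulr0 M); apply: cvgM; first exact: cvg_cst.
  exact: (semigroup_cvg0 C0).
apply/cvgrPdist_le => d d0; near=> h; rewrite sub0r normrN.
have h0 : 0 <= h by near: h; exact: nbhs_right_ge.
rewrite ger0_norm; last first.
  by apply: Nge0; apply: Xsub; apply: XS => //; exact: addr_ge0.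
apply: (@le_trans _ _ (M * N (S h f \- f))); last first.
  by near: h; exact: cvgr_le e0 _ d0.
have XSh := XS h0 Xf.
apply: (le_trans (Ntri (XS (addr_ge0 t0 h0) Xf) (XS t0 XSh) (XS t0 Xf))).
rewrite (semigroup_D C0)// add0r semigroup_subE//.
by apply: MP; exact: Xsub.
Unshelve. all: by end_near. Qed.

Let bounded_by (k : R) := [set s : R | forall f, X f -> N (S s f) <= k * N f].

Let bounded_by_right (k s : R) : 0 <= s ->
  (forall d : R, 0 < d -> exists2 h : R, 0 < h < d & bounded_by k (s + h)) ->
  bounded_by k s.
Proof.
move=> s0 H f Xf; apply/ler_addgt0Pr => e e0.
have [d /= d0 Hd] := cvgr0_norm_le _ (semigroup_right_continuous s0 Xf) _ e0.
have [h /andP[h0 hd] /(_ _ Xf) Bh] := H _ d0.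
have Xsh : X (S (s + h) f) by apply: XS => //; rewrite addr_ge0// ltW.
apply: (le_trans (Nsub (XS s0 Xf) Xsh)).
rewrite addrC lerD// NC//; last exact: XS.
apply: le_trans (ler_norm _) _; apply: Hd => //.
by rewrite /= sub0r normrN gtr0_norm.
Qed.

(* Baire's theorem is applied to the time axis rather than to the space: the
   set of times at which the operator norm is at most k is closed under limits
   from the right, so that the completeness of X plays no role. *)
Let bounded_interval (t : R) : 0 < t -> exists k a b : R,
  [/\ 0 < a, a < b, b < t & forall s : R, a < s < b -> bounded_by k s].
Proof.
move=> t0; apply: contrapT => Hno.
(* Otherwise every subinterval of ]a, b[ contains a time bounded by k, and by [bounded_by_right] all
   of ]a, b[ is bounded by k, against [Hno]. *)
have no (k a b : R) : 0 < a -> a < b -> b < t -> exists a' b' : R,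
    [/\ a <= a', a' < b', b' <= b & forall s : R, a' < s < b' -> ~ bounded_by k s].
  move=> a0 ab bt; apply: contrapT => Hk; apply: Hno; exists k, a, b; split=> //.
  move=> s /andP[as_ sb]; apply: bounded_by_right => [|d d0].
    by rewrite ltW// (lt_trans a0).
  apply: contrapT => Hd; apply: Hk.
  exists s, (Num.min b (s + d)); split => //.
  - exact: ltW.
  - by rewrite lt_min sb ltrDl.
  - by rewrite ge_min lexx.
  - move=> r /andP[sr]; rewrite lt_min => /andP[rb rd] Br.
    apply: Hd; exists (r - s); last by rewrite subrKC.
    by rewrite subr_gt0 sr ltrBlDl.
(* Keeping all times outside ]0, t[ makes [O n] dense in the whole line, as Baire's theorem
   requires. *)
pose O n := (~` (bounded_by n%:R `&` `]0, t[%classic))° : set R.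
have dO n : open (O n) /\ dense (O n).
  split; first exact: open_interior.
  move=> U [x Ux] oU.
  have [Ut|/set0P[y [Uy yt]]] := eqVneq (U `&` `]0, t[) set0.
    exists x; split=> //; rewrite /O /interior; near=> y => -[_ yt].
    have : (U `&` `]0, t[%classic) y.
      by split=> //; near: y; exact: open_nbhs_nbhs.
    by rewrite Ut.
  have /nbhs_ballP[r /= r0 rU] : nbhs y (U `&` `]0, t[).
    by apply: open_nbhs_nbhs; split=> //; apply: openI => //; exact: interval_open.
  have yU z : `|y - z| < r -> U z /\ 0 < z < t.
    by move=> /rU[Uz]; rewrite /= in_itv.
  have [Uy1 /andP[y10 _]] := yU (y - r / 2)
    (ltac:(by rewrite subKr gtr0_norm; lra)).
  have [Uy2 /andP[_ y2t]] := yU (y + r / 2)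
    (ltac:(by rewrite opprD addNKr normrN gtr0_norm; lra)).
  have [a [b [a1 ab b2 Hab]]] := no n%:R (y - r / 2) (y + r / 2) y10
    (ltac:(by lra)) y2t.
  exists ((a + b) / 2); split.
    apply: (proj1 (yU _ _)); rewrite ltr_norml; lra.
  rewrite /O /interior; near=> s => -[+ _]; apply: Hab.
  have : s \in `]a, b[ by near: s; apply: near_in_itvoo; rewrite in_itv /=; lra.
  by rewrite in_itv.
have [||s [s0t Os]] := Baire dO (O := `]0, t[%classic).
- by exists (t / 2); rewrite /= in_itv /=; lra.
- exact: interval_open.
have s0 : 0 <= s by move: s0t; rewrite /= in_itv /= => /andP[/ltW].
(* The operator at time [s] has some bound M, whereas [s] escapes every integer bound. *)
have [M MP] := semigroup_bounded C0 s0.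
have /interior_subset := Os (Num.truncn M).+1 I; apply; split=> // f Xf.
apply: (le_trans (MP _ Xf)); rewrite ler_wpM2r ?Nge0// ltW//.
exact: truncnS_gt.
Unshelve. all: by end_near. Qed.

(** The bound on ]a, b[ is carried to times just before t by composing with the bounded operator at
    time t - c, where c is the midpoint of a and b. *)
Lemma semigroup_locally_bounded (t : R) : 0 < t -> exists M d : R, 0 < d /\
  forall (s : R) f, t - d < s <= t -> X f -> N (S s f) <= M * N f.
Proof.
move=> t0; have [k [a [b [a0 ab bt Hk]]]] := bounded_interval t0.
pose c := (a + b) / 2.
have tc : 0 <= t - c by rewrite /c; lra.
have [M MP] := semigroup_bounded C0 tc.
(* The sign of M is not known, hence the maximum with 0 before multiplying by the second bound. *)
exists (Num.max M 0 * k), ((b - a) / 2); split; first by lra.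
move=> s f /andP[ts st] Xf.
have s0 : 0 <= s - (t - c) by rewrite /c; lra.
rewrite -(subrK (t - c) s) addrC semigroup_addE//.
apply: (le_trans (MP _ (XS s0 Xf))).
apply: (@le_trans _ _ (Num.max M 0 * N (S (s - (t - c)) f))).
  by rewrite ler_wpM2r ?le_max ?lexx//; exact/Nge0/XS.
rewrite -mulrA ler_wpM2l ?le_max ?lexx ?orbT//; apply: Hk => //.
by rewrite /c; lra.
Qed.

(** Up to a null function, S (t - h) f - S t f is S (t - h) applied to f - S h f, so the operators
    at times t - h must be bounded uniformly in small h. *)
Lemma semigroup_left_continuous (t : R) f : 0 < t -> X f ->
  N (S (t - h) f \- S t f) @[h --> 0^'+] --> (0 : R).
Proof.
move=> t0 Xf; have [M [d [d0 Md]]] := semigroup_locally_bounded t0.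
have e0 : M * N (S h f \- f) @[h --> 0^'+] --> (0 : R).
  rewrite -[X in _ --> X](mulr0 M); apply: cvgM; first exact: cvg_cst.
  exact: (semigroup_cvg0 C0).
apply/cvgrPdist_le => e e_gt0; near=> h; rewrite sub0r normrN.
have h0 : 0 <= h by near: h; exact: nbhs_right_ge.
have ht : 0 <= t - h by rewrite subr_ge0; near: h; exact: nbhs_right_le.
have hd : h < d by near: h; exact: nbhs_right_lt.
have Xh := XS h0 Xf; have Xth := XS ht Xf; have Xt := XS (ltW t0) Xf.
have Xthh := XS ht Xh.
rewrite ger0_norm; last by apply/Nge0/Xsub.
apply: (@le_trans _ _ (M * N (S h f \- f))); last first.
  by near: h; exact: cvgr_le e0 _ e_gt0.
have -> : N (S (t - h) f \- S t f) = N (S (t - h) f \- S (t - h) (S h f)).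
  apply: N_eq; try exact: Xsub.
  have := semigroup_D C0 ht h0 Xf; rewrite subrK NC// => <-.
  by congr N; apply/funext => z /=; ring.
rewrite semigroup_subE//.
apply: (le_trans (Md _ _ _ (Xsub Xf Xh))); first by lra.
by rewrite NC.
Unshelve. all: by end_near. Qed.

End C0Semigroup.

(** * Solutions in an abstract space and decay of quadratic forms along them *)

Section Solutions.
Context {R : realType} {L : R}.
Local Notation V := (R * R -> R).
Context {X : set V} (linX : lin_closed X).
Context {B : V -> V -> R} (siB : semi_inner X B).
Context {N : V -> R} (NE : forall f, X f -> N f = snorm B f).
Context (testX : forall phi, test_function L phi -> X phi /\ X (FP phi)).
Context (test_sub : forall phi psi : V,
  test_function L phi -> test_function L psi ->
  test_function L (phi \- psi) /\ FP (phi \- psi) = FP phi \- FP psi).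

Let Xsub := sub_closed linX.
Let Nge0 := N_ge0 NE.
Let Ntri := N_triangle linX siB NE.
Let NC := N_subC linX siB NE.
Let Nlin := N_lin linX siB NE.
Let Neq := N_eq linX siB NE.

Lemma N_eq_trans f g h : X f -> X g -> X h ->
  N (f \- g) = 0 -> N (g \- h) = 0 -> N (f \- h) = 0.
Proof.
move=> Xf Xg Xh fg gh; apply/eqP; rewrite eq_le Nge0 ?andbT; last exact: Xsub.
by rewrite (le_trans (Ntri Xf Xg Xh))// fg gh addr0.
Qed.

Lemma N_eq_lin a f f' g g' : X f -> X f' -> X g -> X g' ->
  N (f \- f') = 0 -> N (g \- g') = 0 -> N (lin a f g \- lin a f' g') = 0.
Proof.
move=> Xf Xf' Xg Xg' ff' gg'.
rewrite (_ : _ \- _ = lin a (f \- f') (g \- g')); last first.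
  by apply/funext => z; rewrite /lin /=; ring.
apply/eqP; rewrite eq_le Nge0 ?andbT; last by apply: linX; exact: Xsub.
by rewrite (le_trans (Nlin _ (Xsub Xf Xf') (Xsub Xg Xg')))// ff' gg' mulr0 addr0.
Qed.

Lemma N_eq_refl f : X f -> N (f \- f) = 0.
Proof.
move=> Xf; rewrite NE; last exact: Xsub.
by rewrite /snorm (si_subl siB)//; [rewrite subrr sqrtr0|exact: Xsub].
Qed.

Let N_squeeze (T : Type) (F : set_system T) {FF : Filter F} (f : T -> V)
    (e : T -> R) :
  (\forall i \near F, X (f i) /\ N (f i) <= e i) -> e i @[i --> F] --> (0 : R) ->
  N (f i) @[i --> F] --> (0 : R).
Proof.
move=> fe e0; apply/cvgrPdist_le => d d0; near=> i; rewrite sub0r normrN.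
have [Xi fi] : X (f i) /\ N (f i) <= e i by near: i.
rewrite ger0_norm ?Nge0//; apply: (le_trans fi).
by near: i; exact: cvgr_le e0 _ d0.
Unshelve. all: by end_near. Qed.

(* u' = - g with g the closure of FP at u.  Right derivatives and left continuity
   suffice for the Gronwall argument, and are what a semigroup gives directly. *)
Record solution (u g : R -> V) : Prop := {
  solution_closure : forall t, 0 <= t -> FP_closure L X N (u t) (g t);
  solution_right : forall t, 0 <= t ->
    N (lin h^-1 (u (t + h) \- u t) (g t)) @[h --> 0^'+] --> (0 : R);
  solution_left : forall t, 0 < t ->
    N (u (t - h) \- u t) @[h --> 0^'+] --> (0 : R) }.

Lemma solution_mem u g t : solution u g -> 0 <= t -> X (u t) /\ X (g t).
Proof. by move=> /solution_closure /[apply] -[]. Qed.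

Section Decay.
Context {Q : V -> V -> R} (siQ : semi_inner X Q).
Context {C : R} (QN : forall f, X f -> snorm Q f <= C * N f).
Context {k : R} (Qtest : forall phi, test_function L phi ->
  k * Q phi phi <= Q phi (FP phi)).

(** Both sides pass to the limit along the sequence that defines the closure, as [Q] is bounded by
    [N]. *)
Lemma closure_coercive f g : FP_closure L X N f g -> k * Q f f <= Q f g.
Proof.
move=> [Xf Xg [phi [tphi phif Pphig]]].
have Xphi n := testX (tphi n).
have c1 : k * Q (phi n) (phi n) @[n --> \oo] --> k * Q f f.
  apply: cvgM; first exact: cvg_cst.
  by apply: (si_cvg linX siQ QN) => //; apply: nearW => n; have [] := Xphi n.
have c2 : Q (phi n) (FP (phi n)) @[n --> \oo] --> Q f g.
  by apply: (si_cvg linX siQ QN) => //; apply: nearW => n; have [] := Xphi n.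
apply: (ler_cvg_to c1 c2); apply: nearW => n; exact: Qtest.
Qed.

(** The right derivative of Q(u, u) is -2 Q(u, g), which [closure_coercive] bounds by -2k Q(u,
    u). *)
Lemma solution_decay u g : solution u g ->
  forall t, 0 <= t -> Q (u t) (u t) <= expR (- (2 * k) * t) * Q (u 0) (u 0).
Proof.
move=> sol; have memu t (t0 : 0 <= t) := solution_mem sol t0.
apply: right_gronwall => t t0.
  apply: (si_cvg linX siQ QN); try by have [] := memu _ (ltW t0).
  - near=> h; have ht : 0 <= t - h by rewrite subr_ge0; near: h; exact: nbhs_right_le.
    by have [] := memu _ ht.
  - near=> h; have ht : 0 <= t - h by rewrite subr_ge0; near: h; exact: nbhs_right_le.
    by have [] := memu _ ht.
  - exact: (solution_left sol).
  - exact: (solution_left sol).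
have [Xu Xg] := memu _ t0.
have Xmg : X (lin (-2) (g t) (g t \- g t)) by apply: linX => //; exact: Xsub.
have Xuh : \forall h \near 0^'+, X (u (t + h)).
  near=> h; have h0 : 0 <= t + h by rewrite addr_ge0//; near: h; exact: nbhs_right_ge.
  by have [] := memu _ h0.
(* Right continuity follows from right differentiability: u(t + h) - u(t) = h w - h g(t), with w
   tending to 0. *)
have right_cont : N (u (t + h) \- u t) @[h --> 0^'+] --> (0 : R).
  apply: (N_squeeze (e := fun h => h * N (lin h^-1 (u (t + h) \- u t) (g t)) + h * N (g t))).
    near=> h; have Xh : X (u (t + h)) by near: h.
    have h0 : 0 < h by near: h; exact: nbhs_right_gt.
    split; first exact: Xsub.
    set w := lin h^-1 _ _; have Xw : X w by apply: linX => //; exact: Xsub.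
    rewrite (_ : _ \- _ = lin h w (lin (- h) (g t) (g t \- g t))); last first.
      by apply/funext => z; rewrite /w /lin /=; field; rewrite gt_eqF.
    have Xgg := Xsub Xg Xg.
    have Xl := linX (- h) Xg Xgg.
    apply: (le_trans (Nlin h Xw Xl)); rewrite gtr0_norm// lerD2l.
    apply: (le_trans (Nlin _ Xg Xgg)).
    by rewrite normrN gtr0_norm// N_eq_refl// addr0.
  rewrite -[X in _ --> X](addr0 0) -[X in _ --> X + _](mul0r 0).
  rewrite -[X in _ --> _ + X](mul0r (N (g t))).
  have id0 : h @[h --> 0^'+] --> (0 : R) by apply: cvg_at_right_filter; exact: cvg_id.
  apply: cvgD; apply: cvgM => //; [exact: solution_right sol _ t0|exact: cvg_cst].
exists (- (2 * Q (u t) (g t))).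
  by rewrite mulNr lerN2 -mulrA ler_pM2l// closure_coercive//; exact: (solution_closure sol).
(* [g t \- g t] plays the zero function, whose membership in [X] is then a consequence of [linX]. *)
pose D h := lin h^-1 (u (t + h) \- u t) (g t \- g t).
(* The factorisation a^2 - b^2 = (a - b)(a + b), read for the form [Q]. *)
have E : \forall h \near 0^'+, Q (D h) (u (t + h)) + Q (D h) (u t) =
   h^-1 * (Q (u (t + h)) (u (t + h)) - Q (u t) (u t)).
  near=> h; have Xh : X (u (t + h)) by near: h.
  have Xd := Xsub Xh Xu; have Xgg := Xsub Xg Xg.
  by rewrite /D !(si_lin siQ)// !(si_subl siQ)// (si_sym siQ Xu Xh); ring.
have XDh : \forall h \near 0^'+, X (D h).
  by near=> h; apply: linX; apply: Xsub => //; near: h.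
have XN : X (lin (-1) (g t) (g t \- g t)) by apply: linX => //; exact: Xsub.
have Dcv : N (D h \- lin (-1) (g t) (g t \- g t)) @[h --> 0^'+] --> (0 : R).
  rewrite (_ : (fun h => _) = fun h => N (lin h^-1 (u (t + h) \- u t) (g t))).
    exact: (solution_right sol).
  by apply/funext => h; congr N; apply/funext => z; rewrite /D /lin /=; ring.
have u_cst : N (u t \- u t) @[h --> (0:R)^'+] --> (0 : R).
  by rewrite N_eq_refl//; exact: cvg_cst.
have -> : - (2 * Q (u t) (g t)) = Q (lin (-1) (g t) (g t \- g t)) (u t) +
    Q (lin (-1) (g t) (g t \- g t)) (u t).
  have Xgg := Xsub Xg Xg.
  by rewrite !(si_lin siQ)// !(si_subl siQ)// (si_sym siQ Xu Xg); ring.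
apply: cvg_trans; first exact: (near_eq_cvg E).
apply: cvgD.
  by apply: (si_cvg linX siQ QN).
by apply: (si_cvg linX siQ QN) => //; exact: nearW.
Unshelve. all: by end_near. Qed.

End Decay.

(** Serves uniqueness: the decay estimate with k = 0 applies to the difference of two solutions. *)
Lemma solution_sub u1 g1 u2 g2 : solution u1 g1 -> solution u2 g2 ->
  solution (fun t => u1 t \- u2 t) (fun t => g1 t \- g2 t).
Proof.
move=> s1 s2; have m1 t (t0 : 0 <= t) := solution_mem s1 t0.
have m2 t (t0 : 0 <= t) := solution_mem s2 t0.
have sum0 (T : Type) (F : set_system T) (FF : Filter F) (a b : T -> V) :
    (\forall i \near F, X (a i)) -> (\forall i \near F, X (b i)) ->
    N (a i) @[i --> F] --> (0 : R) -> N (b i) @[i --> F] --> (0 : R) ->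
    N (a i \- b i) @[i --> F] --> (0 : R).
  move=> Xa Xb a0 b0; apply: (N_squeeze (e := fun i => N (b i) + N (a i))).
    near=> i; have Xi : X (a i) by near: i.
    have Yi : X (b i) by near: i.
    split; first exact: Xsub.
    by rewrite sub_lin (le_trans (Nlin _ Yi Xi))// normrN normr1 mul1r.
  by rewrite -[X in _ --> X](addr0 0); exact: cvgD.
split=> t t0.
- have [Xu1 Xg1 [p1 [t1 pf1 pg1]]] := solution_closure s1 t0.
  have [Xu2 Xg2 [p2 [t2 pf2 pg2]]] := solution_closure s2 t0.
  split; [exact: Xsub|exact: Xsub|exists (fun n => p1 n \- p2 n)].
  have X1 n := testX (t1 n); have X2 n := testX (t2 n).
  split.
  + by move=> n; have [] := test_sub (t1 n) (t2 n).
  + rewrite (_ : (fun n => _) = fun n => N ((p1 n \- u1 t) \- (p2 n \- u2 t))).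
      by apply: sum0 => //; apply: nearW => n; apply: Xsub => //; [case: (X1 n)|case: (X2 n)].
    by apply/funext => n; congr N; apply/funext => z /=; ring.
  + rewrite (_ : (fun n => _) = fun n => N ((FP (p1 n) \- g1 t) \- (FP (p2 n) \- g2 t))).
      by apply: sum0 => //; apply: nearW => n; apply: Xsub => //; [case: (X1 n)|case: (X2 n)].
    apply/funext => n; congr N; have [_ ->] := test_sub (t1 n) (t2 n).
    by apply/funext => z /=; ring.
- have [Xu1 Xg1] := m1 _ t0; have [Xu2 Xg2] := m2 _ t0.
  rewrite (_ : (fun h => _) = fun h => N (lin h^-1 (u1 (t + h) \- u1 t) (g1 t) \-
      lin h^-1 (u2 (t + h) \- u2 t) (g2 t))); last first.
    by apply/funext => h; congr N; apply/funext => z; rewrite /lin /=; ring.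
  apply: (sum0 _ _ _ _ _ _ _ (solution_right s1 t0) (solution_right s2 t0));
    near=> h; apply: linX => //; apply: Xsub => //.
    have h0 : 0 <= t + h by rewrite addr_ge0//; near: h; exact: nbhs_right_ge.
    by have [] := m1 _ h0.
  have h0 : 0 <= t + h by rewrite addr_ge0//; near: h; exact: nbhs_right_ge.
  by have [] := m2 _ h0.
- have [Xu1 Xg1] := m1 _ (ltW t0); have [Xu2 Xg2] := m2 _ (ltW t0).
  rewrite (_ : (fun h => _) = fun h => N ((u1 (t - h) \- u1 t) \- (u2 (t - h) \- u2 t))).
    apply: (sum0 _ _ _ _ _ _ _ (solution_left s1 t0) (solution_left s2 t0));
      near=> h; apply: Xsub => //.
      have ht : 0 <= t - h by rewrite subr_ge0; near: h; exact: nbhs_right_le.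
      by have [] := m1 _ ht.
    have ht : 0 <= t - h by rewrite subr_ge0; near: h; exact: nbhs_right_le.
    by have [] := m2 _ ht.
  by apply/funext => h; congr N; apply/funext => z /=; ring.
Unshelve. all: by end_near. Qed.

Section Semigroup.
Context {S : R -> V -> V} (FPS : FP_semigroup L X N S).

Let C0 := FP_semigroup_C0 FPS.
Let XS (t : R) f : 0 <= t -> X f -> X (S t f) := @semigroup_stable _ _ _ _ C0 t f.

(** Up to null functions both quotients are S t applied to the quotient at time 0. The first gives
    the right derivative of t -> S t f; the second puts S t f in the domain of the generator. *)
Lemma semigroup_difference_quotient (t : R) f p : 0 <= t -> X f -> X p ->
  N (lin h^-1 (S h f \- f) p) @[h --> 0^'+] --> (0 : R) ->
  N (lin h^-1 (S (t + h) f \- S t f) (S t p)) @[h --> 0^'+] --> (0 : R) /\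
  N (lin h^-1 (S h (S t f) \- S t f) (S t p)) @[h --> 0^'+] --> (0 : R).
Proof.
move=> t0 Xf Xp D0; have [M MP] := semigroup_bounded C0 t0.
have e0 : M * N (lin h^-1 (S h f \- f) p) @[h --> 0^'+] --> (0 : R).
  by rewrite -[X in _ --> X](mulr0 M); apply: cvgM => //; exact: cvg_cst.
(* [w h] is S (t + h) f or S h (S t f), both equivalent to S t (S h f). *)
suff H (w : R -> V) : (forall h, 0 <= h -> X (w h)) ->
    (forall h, 0 <= h -> N (w h \- S t (S h f)) = 0) ->
    N (lin h^-1 (w h \- S t f) (S t p)) @[h --> 0^'+] --> (0 : R).
  have dC h : 0 <= h -> N (S (t + h) f \- S t (S h f)) = 0.
    by move=> h0; exact: (semigroup_D C0).
  split; apply: H => // h h0; try (by apply: XS => //; exact: addr_ge0).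
  - exact/XS/XS.
  - have X1 := XS h0 (XS t0 Xf); have X2 := XS (addr_ge0 t0 h0) Xf.
    have X3 := XS t0 (XS h0 Xf).
    apply: (N_eq_trans X1 X2 X3 _ (dC _ h0)).
    by rewrite NC// addrC; exact: (semigroup_D C0).
move=> Xw w0; have Xt := XS t0.
apply: (N_squeeze (e := fun h => M * N (lin h^-1 (S h f \- f) p))) e0.
near=> h; have h0 : 0 <= h by near: h; exact: nbhs_right_ge.
have Xwh := Xw h h0; have Xh := XS h0 Xf; have Xhf := Xsub Xh Xf.
have XD : X (lin h^-1 (S h f \- f) p) by exact: linX.
have Xl : X (lin h^-1 (w h \- S t f) (S t p)).
  by apply: linX; [apply: Xsub => //; exact: Xt|exact: Xt].
split=> //; apply: le_trans (MP _ XD); rewrite le_eqVlt; apply/orP; left.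
apply/eqP/Neq => //; first exact: Xt.
have Xl2 : X (lin h^-1 (S t (S h f \- f)) (S t p)) by apply: linX; exact: Xt.
have Xl3 : X (lin h^-1 (S t (S h f) \- S t f) (S t p)).
  by apply: linX; [apply: Xsub => //; exact: Xt|exact: Xt].
apply: (N_eq_trans Xl Xl2 (Xt _ XD)); last first.
  rewrite NC//; last exact: Xt.
  exact: (semigroup_linear C0 h^-1 t0 Xhf Xp).
apply: (N_eq_trans Xl Xl3 Xl2).
  apply: N_eq_lin; try exact: Xt; try by apply: Xsub => //; exact: Xt.
    rewrite (_ : _ \- _ = w h \- S t (S h f)); first exact: w0.
    by apply/funext => z /=; ring.
  by apply: N_eq_refl; exact: Xt.
apply: N_eq_lin; try exact: Xt; try by apply: Xsub => //; exact: Xt.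
  rewrite NC; [|by apply: Xsub; exact: Xt|exact: Xt].
  rewrite [S h f \- f]sub_lin [S t (S h f) \- S t f]sub_lin.
  exact: (semigroup_linear C0 (-1) t0 Xf Xh).
by apply: N_eq_refl; exact: Xt.
Unshelve. all: by end_near. Qed.

(** A constant sequence shows that a test function is in the closure, and the semigroup commutes
    with its generator. Both directions of [FP_semigroup_generator] serve: one at time 0, the other
    to return to the closure of [FP] at time t. *)
Lemma semigroup_solution phi : test_function L phi ->
  solution (fun t => S t phi) (fun t => S t (FP phi)).
Proof.
move=> tphi; have [Xphi XP] := testX tphi.
have gen0 : generator X N S phi (fun z => - FP phi z).
  apply/(FP_semigroup_generator FPS).
  rewrite (_ : (fun z => _) = FP phi); last by apply/funext => z; rewrite opprK.
  split=> //; exists (fun=> phi); split=> //.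
    by rewrite N_eq_refl//; exact: cvg_cst.
  by rewrite N_eq_refl//; exact: cvg_cst.
have D0 : N (lin h^-1 (S h phi \- phi) (FP phi)) @[h --> 0^'+] --> (0 : R).
  have [_ _] := gen0.
  rewrite (_ : (fun h => _) = fun h => N (lin h^-1 (S h phi \- phi) (FP phi)))//.
  by apply/funext => h; congr N; apply/funext => z; rewrite opprK.
split=> t t0.
- have [_ H] := semigroup_difference_quotient t0 Xphi XP D0.
  have Xt := XS t0 XP; have XN : X (fun z => - S t (FP phi) z).
    (* The opposite of h is -2 h + h, which needs only [lin]. *)
    rewrite (_ : (fun z => _) = lin (-2) (S t (FP phi)) (S t (FP phi))).
      exact: linX.
    by apply/funext => z; rewrite /lin; ring.
  rewrite (_ : S t (FP phi) = fun z => - (- S t (FP phi) z)).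
    apply/(FP_semigroup_generator FPS (S t phi) (fun z => - S t (FP phi) z)).
    split=> //; first exact: XS.
    rewrite (_ : (fun h => _) = fun h => N (lin h^-1 (S h (S t phi) \- S t phi)
        (S t (FP phi))))//.
    by apply/funext => h; congr N; apply/funext => z; rewrite opprK.
  by apply/funext => z; rewrite opprK.
- by have [] := semigroup_difference_quotient t0 Xphi XP D0.
- exact: (semigroup_left_continuous linX siB NE C0).
Qed.

Lemma test_dense f : X f -> exists phi : nat -> V,
  (forall n, test_function L (phi n)) /\ N (phi n \- f) @[n --> \oo] --> (0 : R).
Proof.
move=> Xf.
have ex n : exists phi : V, test_function L phi /\ N (phi \- f) < n.+1%:R^-1.
  have [phi ? ?] := FP_semigroup_dense FPS Xf (ltac:(by rewrite invr_gt0) : 0 < n.+1%:R^-1 :> R).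
  by exists phi.
have [phi Hphi] := choice ex; exists phi; split=> [n|].
  by have [] := Hphi n.
apply: (N_squeeze (e := fun n => n.+1%:R^-1)); last exact: cvg_harmonic.
apply: nearW => n; have [tphi lt] := Hphi n; have [Xphi _] := testX tphi.
by split; [exact: Xsub|exact: ltW].
Qed.

Lemma semigroup_cvg (t : R) (f : V) (phi : nat -> V) : 0 <= t ->
  (forall n, X (phi n)) -> X f -> N (phi n \- f) @[n --> \oo] --> (0 : R) ->
  N (S t (phi n) \- S t f) @[n --> \oo] --> (0 : R).
Proof.
move=> t0 Xphi Xf cphi; have [M MP] := semigroup_bounded C0 t0.
apply: (N_squeeze (e := fun n => M * N (phi n \- f))); last first.
  by rewrite -[X in _ --> X](mulr0 M); apply: cvgM => //; exact: cvg_cst.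
apply: nearW => n; split; first by apply: Xsub; exact: XS.
rewrite (semigroup_subE linX siB NE C0)//; apply: MP; exact: Xsub.
Qed.

(** Test functions start genuine solutions, and both sides are continuous for [N]. The lemma serves
    the energy, with a positive rate, and the squared mean, with rate 0. *)
Lemma semigroup_decay (Q : V -> V -> R) (C k : R) : semi_inner X Q ->
  (forall f, X f -> snorm Q f <= C * N f) ->
  (forall phi, test_function L phi -> k * Q phi phi <= Q phi (FP phi)) ->
  forall f (t : R), X f -> 0 <= t ->
  Q (S t f) (S t f) <= expR (- (2 * k) * t) * Q f f.
Proof.
move=> siQ QN Qtest f t Xf t0.
have [phi [tphi cphi]] := test_dense Xf.
have Xphi n : X (phi n) by have [] := testX (tphi n).
have cS := semigroup_cvg t0 Xphi Xf cphi.
have c1 : Q (S t (phi n)) (S t (phi n)) @[n --> \oo] --> Q (S t f) (S t f).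
  by apply: (si_cvg linX siQ QN) => //; try apply: nearW => n; exact: XS.
(* [solution_decay] refers to S 0 (phi n), which is phi n only up to a null function. *)
have c2 : expR (- (2 * k) * t) * Q (S 0 (phi n)) (S 0 (phi n)) @[n --> \oo] -->
    expR (- (2 * k) * t) * Q f f.
  apply: cvgM; first exact: cvg_cst.
  apply: (si_cvg linX siQ QN) => //; try by apply: nearW => n; exact: XS.
    apply: cvg_trans cphi; apply: near_eq_cvg; apply: nearW => n.
    have X0 := XS (lexx 0) (Xphi n).
    apply: Neq; try exact: Xsub.
    rewrite NC; [|exact: Xsub..].
    rewrite (_ : _ \- _ = S 0 (phi n) \- phi n); first exact: (semigroup_0 C0).
    by apply/funext => z /=; ring.
  apply: cvg_trans cphi; apply: near_eq_cvg; apply: nearW => n.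
  have X0 := XS (lexx 0) (Xphi n).
  apply: Neq; try exact: Xsub.
  rewrite NC; [|exact: Xsub..].
  rewrite (_ : _ \- _ = S 0 (phi n) \- phi n); first exact: (semigroup_0 C0).
  by apply/funext => z /=; ring.
apply: (ler_cvg_to c1 c2); apply: nearW => n.
exact: (solution_decay siQ QN Qtest (semigroup_solution (tphi n))).
Qed.

End Semigroup.
End Solutions.

(** * Differential calculus of smooth functions of (x, v) *)

Section Smooth.
Context {R : realType}.
Local Notation V := (R * R -> R).
Implicit Types f g : V.

(** A boolean direction lets facts about both derivatives be stated once; [(~~ b)%:R] is then the
    derivative of v in the direction b. *)
Definition partial (b : bool) : V -> V := if b then dx else dv.

Let dir (b : bool) : R * R := if b then (1, 0) else (0, 1).

Let partialE b f z : partial b f z = 'D_(dir b) f z.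
Proof. by case: b. Qed.

Definition everywhere_differentiable (f : V) := forall z, differentiable f z.

Lemma smooth_differentiable f : smooth f -> everywhere_differentiable f.
Proof. by move=> sf z; exact: (sf [::] z). Qed.

Lemma smooth_partial b f : smooth f -> smooth (partial b f).
Proof.
move=> sf w z; have := sf (rcons w b) z; rewrite foldr_rcons.
by case: b.
Qed.

Section Rules.
Context {f g : V}.
Hypotheses (df : everywhere_differentiable f) (dg : everywhere_differentiable g).

Lemma partialD b : partial b (fun z => f z + g z) = fun z => partial b f z + partial b g z.
Proof.
by apply/funext => z; rewrite !partialE; apply: deriveD; exact: diff_derivable.
Qed.

Lemma partialM b :
  partial b (fun z => f z * g z) = fun z => partial b f z * g z + f z * partial b g z.
Proof.
apply/funext => z; rewrite !partialE [LHS]deriveM; [|exact: diff_derivable..].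
by rewrite /GRing.scale/= addrC mulrC.
Qed.

Lemma everywhere_differentiableD :
  everywhere_differentiable (fun z => f z + g z).
Proof. by move=> z; exact: differentiableD. Qed.

Lemma everywhere_differentiableM :
  everywhere_differentiable (fun z => f z * g z).
Proof. by move=> z; exact: differentiableM. Qed.

End Rules.

Lemma partial_cst b c : partial b (fun=> c) = fun=> 0.
Proof. by apply/funext => z; rewrite partialE; exact: derive_cst. Qed.

Let snd_linear : {linear (R * R)%type -> R} := snd.

Let snd_continuous : continuous snd_linear.
Proof. by move=> z; exact: cvg_snd. Qed.

Lemma differentiable_snd : everywhere_differentiable snd.
Proof. by move=> z; exact: linear_differentiable snd_continuous. Qed.

Lemma partial_snd b : partial b snd = fun=> (~~ b)%:R.
Proof.
apply/funext => z; rewrite partialE deriveE; last exact: differentiable_snd.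
by rewrite (diff_lin z snd_continuous); case: b.
Qed.

Section ExpComp.
Context {f : V} (df : everywhere_differentiable f).

Lemma everywhere_differentiable_expR :
  everywhere_differentiable (fun z => expR (f z)).
Proof.
move=> z; apply: (@differentiable_comp _ _ _ _ f expR) => //.
exact/derivable1_diffP/derivable_expR.
Qed.

Lemma partial_expR b :
  partial b (fun z => expR (f z)) = fun z => partial b f z * expR (f z).
Proof.
apply/funext => z; rewrite !partialE !deriveE//; last first.
  exact: everywhere_differentiable_expR.
have dexp : differentiable (expR : R -> R) (f z).
  exact/derivable1_diffP/derivable_expR.
rewrite (@diff_comp _ _ _ _ f expR)//= deriv1E//.
by rewrite derive1E derive_val.
Qed.

End ExpComp.

(* [smooth] quantifies over words of derivatives, so that its closure under
   products has no direct induction; it is obtained from a class of functions that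
   both derivatives preserve. *)
Inductive generated : V -> Prop :=
| generated_smooth f : smooth f -> generated f
| generated_cst c : generated (fun=> c)
| generated_snd : generated snd
| generated_gauss a : generated (fun z => expR (a * (z.2 * z.2)))
| generatedD f g : generated f -> generated g -> generated (fun z => f z + g z)
| generatedM f g : generated f -> generated g -> generated (fun z => f z * g z).

Let quad a (z : R * R) : R := a * (z.2 * z.2).

Let diff_quad a : everywhere_differentiable (quad a).
Proof.
apply: everywhere_differentiableM; first by move=> z; exact: differentiable_cst.
by apply: everywhere_differentiableM; exact: differentiable_snd.
Qed.

Let partial_quad a b : partial b (quad a) = fun z => a * ((~~ b)%:R * z.2 + z.2 * (~~ b)%:R).
Proof.
rewrite (@partialM (fun=> a) (fun z => z.2 * z.2)).
- rewrite partial_cst (partialM differentiable_snd differentiable_snd) partial_snd.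
  by apply/funext => z; rewrite mul0r add0r.
- by move=> z; exact: differentiable_cst.
- by apply: everywhere_differentiableM; exact: differentiable_snd.
Qed.

Lemma generated_differentiable f : generated f -> everywhere_differentiable f.
Proof.
elim=> [{}f /smooth_differentiable//|c z||a|{}f g _ df _ dg|{}f g _ df _ dg].
- exact: differentiable_cst.
- exact: differentiable_snd.
- exact: everywhere_differentiable_expR (diff_quad a).
- exact: everywhere_differentiableD.
- exact: everywhere_differentiableM.
Qed.

Lemma generated_partial b f : generated f -> generated (partial b f).
Proof.
elim=> [{}f sf|c||a|{}f g gf df gg dg|{}f g gf df gg dg].
- exact/generated_smooth/smooth_partial.
- by rewrite partial_cst; exact: generated_cst.
- by rewrite partial_snd; exact: generated_cst.
- rewrite (partial_expR (diff_quad a)) partial_quad.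
  apply: (@generatedM (fun z => a * ((~~ b)%:R * z.2 + z.2 * (~~ b)%:R))).
    apply: (@generatedM (fun=> a)); first exact: generated_cst.
    apply: generatedD.
      by apply: (@generatedM (fun=> (~~ b)%:R)); [exact: generated_cst|exact: generated_snd].
    by apply: (generatedM generated_snd); exact: generated_cst.
  exact: generated_gauss.
- by rewrite partialD; [exact: generatedD|exact: generated_differentiable..].
- rewrite partialM; [|exact: generated_differentiable..].
  by apply: generatedD; exact: generatedM.
Qed.

Lemma smooth_generated f : generated f -> smooth f.
Proof.
move=> gf w; apply: generated_differentiable.
by elim: w => [//|b w IH] /=; have := generated_partial b IH; case: b.
Qed.

Lemma smoothD f g : smooth f -> smooth g -> smooth (fun z => f z + g z).
Proof.
by move=> sf sg; apply/smooth_generated/generatedD; exact: generated_smooth.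
Qed.

Lemma smoothM f g : smooth f -> smooth g -> smooth (fun z => f z * g z).
Proof.
by move=> sf sg; apply/smooth_generated/generatedM; exact: generated_smooth.
Qed.

Lemma smooth_cst (c : R) : smooth ((fun=> c) : V).
Proof. exact/smooth_generated/generated_cst. Qed.

Lemma smooth_snd : smooth (snd : V).
Proof. exact/smooth_generated/generated_snd. Qed.

(** Taken with a = -1/2 for the Gaussian weight and with a = 1/2 for its inverse. *)
Lemma smooth_gauss (a : R) : smooth ((fun z => expR (a * (z.2 * z.2))) : V).
Proof. exact/smooth_generated/generated_gauss. Qed.

Lemma partial_gauss b (a : R) : partial b (fun z => expR (a * (z.2 * z.2))) =
  fun z => (~~ b)%:R * (a * z.2 *+ 2) * expR (a * (z.2 * z.2)).
Proof.
rewrite (partial_expR (diff_quad a)) partial_quad.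
by apply/funext => z; rewrite /quad; congr (_ * _); ring.
Qed.

Lemma partialDs b f g : smooth f -> smooth g ->
  partial b (fun z => f z + g z) = fun z => partial b f z + partial b g z.
Proof. by move=> sf sg; apply: partialD; exact: smooth_differentiable. Qed.

Lemma partialMs b f g : smooth f -> smooth g ->
  partial b (fun z => f z * g z) = fun z => partial b f z * g z + f z * partial b g z.
Proof. by move=> sf sg; apply: partialM; exact: smooth_differentiable. Qed.

Lemma dx_is_derive f x v : smooth f -> is_derive x (1 : R) (fun y => f (y, v)) (dx f (x, v)).
Proof.
move=> sf; have d : derivable f (x, v) (1, 0).
  exact/diff_derivable/smooth_differentiable.
have E : (fun h : R => h^-1 *: (((fun y => f (y, v)) \o shift x) (h *: 1) - f (x, v))) =
    (fun h => h^-1 *: ((f \o shift (x, v)) (h *: (1, 0)) - f (x, v))).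
  apply/funext => h /=; congr (_ *: (f _ - _)).
  by rewrite (_ : _ + (x, v) = (h * 1 + x, h * 0 + v))// mulr0 add0r.
by apply: DeriveDef; rewrite /derivable /derive E.
Qed.

Lemma dv_is_derive f x v : smooth f -> is_derive v (1 : R) (fun w => f (x, w)) (dv f (x, v)).
Proof.
move=> sf; have d : derivable f (x, v) (0, 1).
  exact/diff_derivable/smooth_differentiable.
have E : (fun h : R => h^-1 *: (((fun w => f (x, w)) \o shift v) (h *: 1) - f (x, v))) =
    (fun h => h^-1 *: ((f \o shift (x, v)) (h *: (0, 1)) - f (x, v))).
  apply/funext => h /=; congr (_ *: (f _ - _)).
  by rewrite (_ : _ + (x, v) = (h * 0 + x, h * 1 + v))// mulr0 add0r.
by apply: DeriveDef; rewrite /derivable /derive E.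
Qed.

Lemma smooth_continuous f : smooth f -> continuous f.
Proof.
by move=> sf z; apply/differentiable_continuous; exact: smooth_differentiable.
Qed.

End Smooth.

Section Schwarz.
Context {R : realType}.
Local Notation V := (R * R -> R).
Implicit Type f : V.

Lemma everywhere_derivable_MVT (F dF : R -> R) (a b : R) : a < b ->
  (forall t : R, is_derive t 1 F (dF t)) ->
  exists c, a < c < b /\ F b - F a = dF c * (b - a).
Proof.
move=> ab dFt; have [|c cab ->] := @MVT _ F dF a b ab (fun t _ => dFt t).
  apply: continuous_subspaceT => t.
  by apply/differentiable_continuous/derivable1_diffP; case: (dFt t).
by exists c; split=> //; move: cab; rewrite in_itv.
Qed.

(** The mean value theorem in x for the increment of f in v, then in v for [dx f]; the companion
    lemma takes the variables in the other order. *)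
Lemma second_difference_dvdx f x v (h : R) : smooth f -> 0 < h ->
  exists p : R * R, [/\ x < p.1 < x + h, v < p.2 < v + h &
    f (x + h, v + h) - f (x + h, v) - (f (x, v + h) - f (x, v)) =
    h ^+ 2 * dv (dx f) p].
Proof.
move=> sf h0; have xh : x < x + h by rewrite ltrDl.
have vh : v < v + h by rewrite ltrDl.
have [c [cx E1]] := @everywhere_derivable_MVT
  (fun s => f (s, v + h) - f (s, v)) (fun s => dx f (s, v + h) - dx f (s, v)) _ _ xh
  (fun t => is_deriveB (dx_is_derive t (v + h) sf) (dx_is_derive t v sf)).
have [d [dv_ E2]] := @everywhere_derivable_MVT
  (fun w => dx f (c, w)) (fun w => dv (dx f) (c, w)) _ _ vh
  (fun t => dv_is_derive c t (smooth_partial true sf)).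
exists (c, d); split=> //; move: E1; rewrite E2 => ->; ring.
Qed.

Lemma second_difference_dxdv f x v (h : R) : smooth f -> 0 < h ->
  exists p : R * R, [/\ x < p.1 < x + h, v < p.2 < v + h &
    f (x + h, v + h) - f (x + h, v) - (f (x, v + h) - f (x, v)) =
    h ^+ 2 * dx (dv f) p].
Proof.
move=> sf h0; have xh : x < x + h by rewrite ltrDl.
have vh : v < v + h by rewrite ltrDl.
have [d [dv_ E1]] := @everywhere_derivable_MVT
  (fun w => f (x + h, w) - f (x, w)) (fun w => dv f (x + h, w) - dv f (x, w)) _ _ vh
  (fun t => is_deriveB (dv_is_derive (x + h) t sf) (dv_is_derive x t sf)).
have [c [cx E2]] := @everywhere_derivable_MVT
  (fun s => dv f (s, d)) (fun s => dx (dv f) (s, d)) _ _ xh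
  (fun t => dx_is_derive t d (smooth_partial false sf)).
exists (c, d); split=> //.
move: E1; rewrite E2 (_ : f (x + h, v + h) - _ - _ =
  f (x + h, v + h) - f (x, v + h) - (f (x + h, v) - f (x, v))); last by ring.
by move=> ->; ring.
Qed.

(** Over a small square the same second difference is the area times each mixed derivative, taken at
    two points of the square; continuity brings both points to the corner. *)
Lemma dx_dv f : smooth f -> dx (dv f) = dv (dx f).
Proof.
move=> sf; apply/funext => -[x v].
have c1 : dx (dv f) z @[z --> (x, v)] --> dx (dv f) (x, v).
  exact: (@smooth_continuous _ _ (smooth_partial true (smooth_partial false sf)) (x, v)).
have c2 : dv (dx f) z @[z --> (x, v)] --> dv (dx f) (x, v).
  exact: (@smooth_continuous _ _ (smooth_partial false (smooth_partial true sf)) (x, v)).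
apply/eqP; rewrite -subr_eq0 -normr_le0; apply/ler_addgt0Pr => e e0.
have e2 : 0 < e / 2 by rewrite divr_gt0.
have /nbhs_ballP[r /= r0 Hr] : \forall p \near (x, v),
    `|dx (dv f) (x, v) - dx (dv f) p| < e / 2 /\
    `|dv (dx f) (x, v) - dv (dx f) p| < e / 2.
  move: c1 => /cvgrPdist_lt/(_ _ e2) n1.
  move: c2 => /cvgrPdist_lt/(_ _ e2) n2.
  exact: filterI n1 n2.
have h0 : 0 < r / 2 by rewrite divr_gt0.
have inball (p : R * R) : x < p.1 < x + r / 2 -> v < p.2 < v + r / 2 ->
    ball (x, v) r p.
  by move=> /andP[? ?] /andP[? ?]; split=> /=; rewrite /ball /= ltr_norml; lra.
have [p [p1 p2 Ep]] := second_difference_dvdx x v sf h0.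
have [q [q1 q2 Eq]] := second_difference_dxdv x v sf h0.
have [_ Hp] := Hr _ (inball _ p1 p2); have [Hq _] := Hr _ (inball _ q1 q2).
have E : dv (dx f) p = dx (dv f) q.
  have r2 : (r / 2) ^+ 2 != 0 by rewrite expf_neq0// gt_eqF.
  exact: (mulfI r2 (etrans (esym Ep) Eq)).
move: Hp Hq; rewrite E [0 + e]add0r.
move: (dx (dv f) (x, v)) (dv (dx f) (x, v)) (dx (dv f) q) => a b c bc ac.
by move: bc ac; clear; rewrite !ltr_norml ler_norml => /andP[? ?] /andP[? ?]; lra.
Qed.

End Schwarz.

(** * Stability properties of test functions *)

Section TestFunctions.
Context {R : realType} {L : R}.
Local Notation V := (R * R -> R).
Implicit Types f g phi psi : V.

Definition x_periodic f := forall x v, f (x + L, v) = f (x, v).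

Lemma test_smooth f : test_function L f -> smooth f.
Proof. by case. Qed.

Lemma x_periodic_partial b f : x_periodic f -> x_periodic (partial b f).
Proof.
move=> pf x v; have pf' (z : R * R) : f (z + (L, 0)) = f z.
  by case: z => y w; rewrite -(pf y w) -[in RHS](addr0 w).
have -> : (x + L, v) = (x, v) + (L, 0) by rewrite -[in LHS](addr0 v).
have E (d z : R * R) : 'D_d f (z + (L, 0)) = 'D_d f z.
  rewrite /derive (_ : (fun h => _) = (fun h => h^-1 *:
    ((f \o shift z) (h *: d) - f z)))//.
  by apply/funext => h /=; rewrite addrA !pf'.
by case: b; exact: E.
Qed.

Lemma test_partial b f : test_function L f -> test_function L (partial b f).
Proof.
case=> sf pf [M Mf]; split; [exact: smooth_partial|exact: x_periodic_partial|].
exists M => x v Mv.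
(* The region M < |v| is open, so f vanishes near each of its points, and so does the derivative
   there. *)
have f0 : {near (x, v), f =1 cst 0}.
  have : \forall z \near (x, v), M < `|z.2|.
    have cv : `|z.2| @[z --> (x, v)] --> `|v|.
      by apply: (cvg_norm (f := snd)); exact: cvg_snd.
    by move: cv => /cvgr_gt/(_ _ Mv).
  by apply: filterS => -[y w] /=; exact: Mf.
by rewrite /partial; case: b; rewrite /dx /dv (near_eq_derive _ f0)//;
  [rewrite derive_cst|rewrite derive_cst].
Qed.

Lemma testM f g : test_function L f -> smooth g -> x_periodic g ->
  test_function L (fun z => f z * g z).
Proof.
case=> sf pf [M Mf] sg pg; split; first exact: smoothM.
  by move=> x v; rewrite pf pg.
by exists M => x v /Mf ->; rewrite mul0r.
Qed.

Lemma testMl f g : test_function L f -> smooth g -> x_periodic g ->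
  test_function L (fun z => g z * f z).
Proof.
move=> tf sg pg; rewrite (_ : (fun z => _) = fun z => f z * g z).
  exact: testM.
by apply/funext => z; rewrite mulrC.
Qed.

Lemma testMM f g : test_function L f -> test_function L g ->
  test_function L (fun z => f z * g z).
Proof. by move=> tf [? ? _]; exact: testM. Qed.

Lemma testD f g : test_function L f -> test_function L g ->
  test_function L (fun z => f z + g z).
Proof.
move=> [sf pf [M Mf]] [sg pg [K Kg]]; split; first exact: smoothD.
  by move=> x v; rewrite pf pg.
exists (Num.max M K) => x v; rewrite gt_max => /andP[/Mf -> /Kg ->].
by rewrite addr0.
Qed.

Lemma testZ c f : test_function L f -> test_function L (fun z => c * f z).
Proof. by move=> tf; apply: (testMl tf) => //; exact: smooth_cst. Qed.

Lemma testN f : test_function L f -> test_function L (fun z => - f z).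
Proof.
move=> /(testZ (-1)); rewrite (_ : (fun z => -1 * _) = fun z => - f z)//.
by apply/funext => z; rewrite mulN1r.
Qed.

Lemma test_snd f : test_function L f -> test_function L (fun z => z.2 * f z).
Proof. by move=> tf; apply: (testMl tf) => //; exact: smooth_snd. Qed.

Lemma test_FP f : test_function L f -> test_function L (FP f).
Proof.
move=> tf; have tx := test_partial true tf; have tv := test_partial false tf.
have tvv := test_partial false tv.
apply: (@testD (fun z => z.2 * dx f z)); first exact: test_snd.
by apply: testD; [exact: testN|exact: test_snd].
Qed.

Lemma partialZ b c f : smooth f ->
  partial b (fun z => c * f z) = fun z => c * partial b f z.
Proof.
move=> sf; rewrite (partialMs b (smooth_cst c) sf) partial_cst.
by apply/funext => z; rewrite mul0r add0r.
Qed.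

Lemma test_sub phi psi : test_function L phi -> test_function L psi ->
  test_function L (phi \- psi) /\ FP (phi \- psi) = FP phi \- FP psi.
Proof.
move=> t1 t2; have t3 := testZ (-1) t2.
have E : phi \- psi = fun z => phi z + -1 * psi z.
  by apply/funext => z /=; rewrite mulN1r.
split; first by rewrite E; exact: testD.
have D b (f g : V) : test_function L f -> test_function L g ->
    partial b (fun z => f z + -1 * g z) = fun z => partial b f z + -1 * partial b g z.
  move=> tf tg; rewrite partialDs ?partialZ//; try exact: test_smooth.
  exact/test_smooth/testZ.
have Dx := D true _ _ t1 t2; have Dv := D false _ _ t1 t2.
have Dvv := D false _ _ (test_partial false t1) (test_partial false t2).
rewrite /partial in Dx Dv Dvv.
apply/funext => z; rewrite /FP E Dx Dv Dvv /=.
move: (dx phi z) (dx psi z) (dv phi z) (dv psi z) (dv (dv phi) z) (dv (dv psi) z).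
by move=> a b c d e f; ring.
Qed.

End TestFunctions.

(** * The pointwise energy identity *)

Section Coercivity.
Context {R : realType} {L : R}.
Local Notation V := (R * R -> R).
Implicit Types f g : V.

(** Carrying smoothness along with the derivative lets the derivative of a compound expression be
    assembled from the rules below. *)
Definition has_partial b f g := smooth f /\ partial b f = g.

Lemma has_partial_snd b : has_partial b snd (fun=> (~~ b)%:R).
Proof. by split; [exact: smooth_snd|exact: partial_snd]. Qed.

Lemma has_partial_cst b (c : R) : has_partial b (fun=> c) (fun=> 0).
Proof. by split; [exact: smooth_cst|exact: partial_cst]. Qed.

Lemma has_partialD b f f' g g' : has_partial b f f' -> has_partial b g g' ->
  has_partial b (fun z => f z + g z) (fun z => f' z + g' z).
Proof.
by move=> [sf <-] [sg <-]; split; [exact: smoothD|exact: partialDs].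
Qed.

Lemma has_partialM b f f' g g' : has_partial b f f' -> has_partial b g g' ->
  has_partial b (fun z => f z * g z) (fun z => f' z * g z + f z * g' z).
Proof.
by move=> [sf <-] [sg <-]; split; [exact: smoothM|exact: partialMs].
Qed.

Lemma has_partialN b f f' : has_partial b f f' ->
  has_partial b (fun z => - f z) (fun z => - f' z).
Proof.
move=> hf; have := has_partialM (has_partial_cst b (-1)) hf.
by congr has_partial; apply/funext => z; ring.
Qed.

(** The expansion of 10 f g + d_v f d_v g + (d_x f + d_v f)(d_x g + d_v g): the integrand of the
    polarised energy, without its mean term. *)
Definition energy_density f g (z : R * R) : R :=
  10 * (f z * g z) + 2 * (dv f z * dv g z)
  + (dx f z * dv g z + dv f z * dx g z) + dx f z * dx g z.

(* The energy density of f and FP f is W up to the derivatives d_x G1 and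
   d_v G2 - v G2, whose integrals against dmu dnu vanish. *)
Let W (fx fv fxv fvv : V) : V := fun z => 12 * fv z ^+ 2 + 3 * (fv z * fx z)
  + fx z ^+ 2 + 2 * fvv z ^+ 2 + 2 * (fxv z * fvv z) + fxv z ^+ 2.

Let G1 (f fx fv : V) : V := fun z =>
  z.2 * (5 * (f z * f z) + fv z * fv z + fx z * fv z + 2^-1 * (fx z * fx z)).

Let G2 (f fx fv fxv fvv : V) : V := fun z => 10 * (f z * fv z)
  + 2 * (fv z * fvv z) + (fx z * fvv z + fv z * fxv z) + fx z * fxv z.

Let P (fx fv fvv : V) : V := fun z => z.2 * fx z + (- fvv z + z.2 * fv z).

(** [G1] is v times half the energy density of f, from the transport term; [G2] is the energy
    density of f against d_v f, from integrating -d_v + v by parts. What remains in [W] is the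
    energy density of d_v f and the share 2 fv (fx + fv) + fx (fx + fv) of the commutator [d_v, P] =
    d_x + d_v. Derivatives are variables, the mixed ones shared, so the identity becomes
    algebraic. *)
Let energy_identity_partial f fx fv fxx fxv fvv fvvv fxvv z :
  has_partial true f fx -> has_partial false f fv ->
  has_partial true fx fxx -> has_partial false fx fxv ->
  has_partial true fv fxv -> has_partial false fv fvv ->
  has_partial true fvv fxvv -> has_partial false fvv fvvv ->
  has_partial false fxv fxvv ->
  10 * (f z * P fx fv fvv z) + 2 * (fv z * partial false (P fx fv fvv) z)
  + (fx z * partial false (P fx fv fvv) z + fv z * partial true (P fx fv fvv) z)
  + fx z * partial true (P fx fv fvv) z =
  W fx fv fxv fvv z + (partial true (G1 f fx fv) z
    - (partial false (G2 f fx fv fxv fvv) z - z.2 * G2 f fx fv fxv fvv z)).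
Proof.
move=> hx hv hxx hxv hvx hvv hxvv hvvv hxvv'.
have hs b : has_partial b (fun z : R * R => z.2) (fun=> (~~ b)%:R).
  exact: has_partial_snd.
have hc b c : has_partial b (fun _ : R * R => c) (fun=> 0) by exact: has_partial_cst.
have [_ Px] := has_partialD (has_partialM (hs true) hxx)
  (has_partialD (has_partialN hxvv) (has_partialM (hs true) hvx)).
have [_ Pv] := has_partialD (has_partialM (hs false) hxv)
  (has_partialD (has_partialN hvvv) (has_partialM (hs false) hvv)).
have [_ E1] := has_partialM (hs true) (has_partialD (has_partialD (has_partialD
  (has_partialM (hc true 5) (has_partialM hx hx)) (has_partialM hvx hvx))
  (has_partialM hxx hvx)) (has_partialM (hc true 2^-1) (has_partialM hxx hxx))).
have [_ E2] := has_partialD (has_partialD (has_partialD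
  (has_partialM (hc false 10) (has_partialM hv hvv))
  (has_partialM (hc false 2) (has_partialM hvv hvvv)))
  (has_partialD (has_partialM hxv hvvv) (has_partialM hvv hxvv')))
  (has_partialM hxv hxvv').
rewrite [partial true (P _ _ _)]Px [partial false (P _ _ _)]Pv.
rewrite [partial true (G1 _ _ _)]E1 [partial false (G2 _ _ _ _ _)]E2.
by rewrite /P /G1 /G2 /W /=; field.
Qed.

(** The cross term 3 fv fx is absorbed by 12 fv^2 and fx^2, and the second derivatives form (fvv +
    fxv)^2 + fvv^2. *)
Let W_ge fx fv fxv fvv z : (fx z ^+ 2 + fv z ^+ 2) / 2 <= W fx fv fxv fvv z.
Proof.
rewrite /W; move: (fx z) (fv z) (fvv z) (fxv z) => a b c d.
rewrite -subr_ge0 (_ : _ - _ = (b *+ 3 + a / 2) ^+ 2 + 2^-1 * (b ^+ 2 *+ 5)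
   + 4^-1 * a ^+ 2 + (c + d) ^+ 2 + c ^+ 2).
  by rewrite !addr_ge0// ?sqr_ge0// mulr_ge0// ?mulrn_wge0 ?sqr_ge0.
by field.
Qed.

Lemma energy_identity f : test_function L f -> exists W G1 G2 : V,
  [/\ test_function L G1, test_function L G2,
      forall z, energy_density f (FP f) z = W z + (dx G1 z - (dv G2 z - z.2 * G2 z)) &
      forall z, (dx f z ^+ 2 + dv f z ^+ 2) / 2 <= W z].
Proof.
move=> tf; have sf := test_smooth tf.
have tx := test_partial true tf; have tv := test_partial false tf.
have tvv := test_partial false tv; have txv := test_partial false tx.
have hp b (g : V) (tg : test_function L g) : has_partial b g (partial b g).
  by split; [exact: test_smooth tg|].
have hvx : has_partial true (dv f) (dv (dx f)).
  by rewrite -(dx_dv sf); exact: hp tv.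
have hxvv : has_partial true (dv (dv f)) (dv (dv (dx f))).
  by rewrite -(dx_dv sf) -(dx_dv (test_smooth tv)); exact: hp tvv.
exists (W (dx f) (dv f) (dv (dx f)) (dv (dv f))), (G1 f (dx f) (dv f)),
  (G2 f (dx f) (dv f) (dv (dx f)) (dv (dv f))); split.
- exact: (test_snd (testD (testD (testD (testZ 5 (testMM tf tf)) (testMM tv tv))
    (testMM tx tv)) (testZ 2^-1 (testMM tx tx)))).
- exact: (testD (testD (testD (testZ 10 (testMM tf tv)) (testZ 2 (testMM tv tvv)))
    (testD (testMM tx tvv) (testMM tv txv))) (testMM tx txv)).
- move=> z; exact: (energy_identity_partial z (hp true f tf) (hp false f tf)
    (hp true _ tx) (hp false _ tx) hvx (hp false _ tv) hxvv (hp false _ tvv)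
    (hp false _ txv)).
- by move=> z; exact: W_ge.
Qed.

End Coercivity.

(** * Measurability in the plane and measures given by a density *)

Section PlaneMeasurability.
Context {R : realType}.

(** An open set is the union of the countably many squares of rational centre and radius that it
    contains, and these are products of measurable sets. *)
Lemma open_measurable_plane (A : set (R * R)) : open A -> measurable A.
Proof.
move=> oA.
pose box (i : rat * rat * rat) : set (R * R) :=
  ball (ratr i.1.1 : R) (ratr i.2) `*` ball (ratr i.1.2 : R) (ratr i.2).
pose F i := if pselect (box i `<=` A) then box i else set0.
have -> : A = \bigcup_i F i.
  apply/seteqP; split=> [[x v] Axv|z [i _]]; last first.
    by rewrite /F; case: pselect => [bA /bA|? []].
  have /nbhs_ballP[r /= r0 rA] : nbhs (x, v) A by exact: open_nbhs_nbhs.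
  have [q q0 qr] : exists2 q : rat, 0 < (ratr q : R) & ratr q < r / 2.
    have : 0 < r / 2 by rewrite divr_gt0.
    by move=> /rat_in_itvoo[q]; rewrite in_itv /= => /andP[? ?]; exists q.
  have near_rat (y : R) : exists p : rat, ball (ratr p : R) (ratr q) y.
    have : y - ratr q < y + ratr q by rewrite ltrBlDr -addrA ltrDl addr_gt0.
    move=> /rat_in_itvoo[p]; rewrite in_itv /= => /andP[? ?]; exists p.
    by rewrite /ball /= ltr_norml; lra.
  have [p px] := near_rat x; have [s sv] := near_rat v.
  have boxA : box (p, s, q) `<=` A.
    move=> [y w] [/= py sw]; apply: rA; split => /=.
      by move: px py; rewrite /ball /= !ltr_norml; lra.
    by move: sv sw; rewrite /ball /= !ltr_norml; lra.
  exists (p, s, q) => //; rewrite /F; case: pselect => [?|/(_ boxA)//] /=.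
  by split.
apply: countable_bigcupT_measurable; first exact: countableP.
move=> i; rewrite /F; case: pselect => [?|?] /=; last exact: measurable0.
by apply: measurableX; exact: measurable_ball.
Qed.

Lemma continuous_measurable_plane (f : R * R -> R) :
  continuous f -> measurable_fun setT f.
Proof.
move=> cf; apply: (measurability _ (RGenOpens.measurableE R)).
move=> _ [_ [a [b ->] <-]]; rewrite setTI; apply: open_measurable_plane.
by apply: open_comp => // z _; exact: cf.
Qed.

End PlaneMeasurability.

(** A nonnegative density commutes with positive and negative parts, so the formula extends to
    signed functions. *)
Lemma integral_density_ge0 d (T : measurableType d) (R : realType)
    (mu nu : {measure set T -> \bar R}) (g : T -> R) : (forall x, 0 <= g x) ->
  (forall f, measurable_fun setT f -> (forall x, 0 <= f x)%E ->
    (\int[nu]_x f x = \int[mu]_x (f x * (g x)%:E))%E) ->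
  forall f, measurable_fun setT f ->
    (\int[nu]_x f x = \int[mu]_x (f x * (g x)%:E))%E.
Proof.
move=> g0 nuE f mf; rewrite [LHS]integralE [RHS]integralE.
congr (_ - _)%E; rewrite nuE//.
- apply: eq_integral => x _; rewrite !funeposE !(muleC _ (g x)%:E).
  by rewrite maxe_pMr ?lee_fin// mule0.
- exact: measurable_funepos.
- apply: eq_integral => x _; rewrite !funenegE !(muleC _ (g x)%:E).
  by rewrite maxe_pMr ?lee_fin// mule0 muleN.
- exact: measurable_funeneg.
Qed.

Section Density.
Context d (T : measurableType d) (R : realType).
Variables (mu : {sigma_finite_measure set T -> \bar R}).
Variables (nu : {finite_measure set T -> \bar R}) (g : T -> R).
Hypotheses (mg : measurable_fun setT g) (g0 : forall x, 0 <= g x).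
Hypothesis nuE : forall A, measurable A -> nu A = (\int[mu]_(x in A) (g x)%:E)%E.

Let nu_dominated : nu `<< mu.
Proof.
apply/null_content_dominatesP => A mA A0; rewrite nuE//.
by apply: null_set_integral => //; apply/measurable_EFinP/measurable_funTS.
Qed.

Let nu_densityE :
  ae_eq mu setT (Radon_Nikodym_SigmaFinite.f nu mu) (EFin \o g).
Proof.
apply: integral_ae_eq => //.
- exact: Radon_Nikodym_SigmaFinite.f_integrable.
- exact/measurable_EFinP.
- by move=> A _ mA; rewrite -Radon_Nikodym_SigmaFinite.f_integral// nuE.
Qed.

(** The Radon-Nikodym derivative of [nu] equals [g] almost everywhere, which makes the abstract
    change of variables explicit. *)
Lemma ge0_integral_density (f : T -> \bar R) :
  measurable_fun setT f -> (forall x, 0 <= f x)%E ->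
  (\int[nu]_x f x = \int[mu]_x (f x * (g x)%:E))%E.
Proof.
move=> mf f0.
rewrite -(Radon_Nikodym_SigmaFinite.change_of_variables nu_dominated f0)//.
apply: ae_eq_integral => //.
- apply: emeasurable_funM => //.
  exact: measurable_int (Radon_Nikodym_SigmaFinite.f_integrable nu_dominated).
- by apply: emeasurable_funM => //; exact/measurable_EFinP.
- exact: ae_eqe_mul2l nu_densityE.
Qed.

Lemma integral_density (f : T -> \bar R) : measurable_fun setT f ->
  (\int[nu]_x f x = \int[mu]_x (f x * (g x)%:E))%E.
Proof. exact: (integral_density_ge0 g0 ge0_integral_density). Qed.

End Density.

(** * The space L^2 of the phase measure *)

Section PhaseL2.
Context {R : realType} {L : R} (L_gt0 : 0 < L).
Local Notation V := (R * R -> R).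
Implicit Types f g h : V.
Local Notation m := (phase_measure L_gt0).

HB.instance Definition _ := Probability.copy m
  (uniform_prob L_gt0 \x normal_prob (0 : R) 1)%E.

Definition ip f g : R := \int[m]_z (f z * g z).

Lemma L2_mul_integrable f g : L2 L_gt0 f -> L2 L_gt0 g ->
  m.-integrable setT (EFin \o (fun z => f z * g z)).
Proof.
by move=> f2 g2; have /Lfun1_integrable := Lfun2_mul_Lfun1 f2 g2.
Qed.

Lemma L2_integrable f : L2 L_gt0 f -> m.-integrable setT (EFin \o f).
Proof.
move=> f2; apply/Lfun1_integrable; apply: Lfun_subset12 f2.
by rewrite [X in X \is a _](_ : _ = 1%E)//; exact: probability_setT.
Qed.

Lemma bounded_L2 f (M : R) : measurable_fun setT f -> (forall z, `|f z| <= M) ->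
  L2 L_gt0 f.
Proof.
move=> mf fM; rewrite /L2 /= inE; apply/andP; split; rewrite inE//=.
rewrite /finite_norm unlock /Lnorm poweR_lty//.
apply: (@le_lt_trans _ _ (\int[m]_z (`|M| `^ 2)%:E)%E); last first.
  by rewrite integral_cst//= probability_setT mule1 ltry.
  apply: ge0_le_integral => //.
  - by move=> z _; exact: poweR_ge0.
  - apply/measurable_EFinP.
    apply: (@measurableT_comp _ _ _ _ _ _ (@powR R ^~ 2)) => //.
    exact: measurableT_comp.
  - move=> z _ /=; rewrite lee_fin ge0_ler_powR// ?nnegrE//.
    by rewrite (le_trans (fM z))// ler_norm.
Qed.

Lemma L2_lin_closed : lin_closed (L2 L_gt0).
Proof.
move=> a f g f2 g2; rewrite /L2 /=.
have -> : lin a f g = (a \o* f) + g.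
  by apply/funext => z; rewrite /lin /= mulrC.
have [_ D] := @Lfun_addr_closed _ _ _ m 2%:E (lee1n 2).
by apply: D => //; apply: Lfun_scale => //; rewrite ler1n.
Qed.

Lemma ip_semi_inner : semi_inner (L2 L_gt0) ip.
Proof.
split.
- by move=> f g _ _; apply: eq_Rintegral => z _; rewrite mulrC.
- move=> a f g h f2 g2 h2; rewrite /ip.
  have fh := L2_mul_integrable f2 h2; have gh := L2_mul_integrable g2 h2.
  rewrite -RintegralZl// -RintegralD//; last first.
    by have := integrableZl measurableT a fh.
  by apply: eq_Rintegral => z _; rewrite /lin; ring.
- by move=> f f2; apply: Rintegral_ge0 => z _; rewrite -expr2 sqr_ge0.
Qed.

Lemma L2normE f : L2 L_gt0 f -> L2norm L_gt0 f = snorm ip f.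
Proof.
move=> f2; rewrite /L2norm /snorm.
have i2 := L2_mul_integrable f2 f2.
have E : (\int[m]_z (f z * f z)%:E = (ip f f)%:E)%E.
  by rewrite /ip /Rintegral fineK//; exact: integrable_fin_num.
rewrite unlock /Lnorm (_ : \int[m]_z _ = (ip f f)%:E)%E.
  by rewrite poweR_EFin /= powR12_sqrt//; exact: (si_ge0 ip_semi_inner).
rewrite -E; apply: eq_integral => z _ /=.
by rewrite powR_mulrn// real_normK ?num_real// expr2.
Qed.

Lemma ip_eq0 f h : L2 L_gt0 f -> L2 L_gt0 h -> L2norm L_gt0 f = 0 -> ip f h = 0.
Proof.
move=> f2 h2 f0; apply/eqP; rewrite -normr_le0.
apply: (le_trans (le_snorm L2_lin_closed ip_semi_inner f2 h2)).
by rewrite -(L2normE f2) f0 mul0r.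
Qed.

End PhaseL2.

Section TestL2.
Context {R : realType} {L : R} (L_gt0 : 0 < L).
Local Notation V := (R * R -> R).
Implicit Type f : V.

Lemma x_periodic_int f (k : int) x v : x_periodic (L := L) f ->
  f (x + k%:~R * L, v) = f (x, v).
Proof.
move=> pf; have pn (n : nat) y : f (y + n%:R * L, v) = f (y, v).
  elim: n y => [|n IH] y; first by rewrite mul0r addr0.
  by rewrite -natr1 mulrDl mul1r addrA pf.
case: k => n; first exact: pn.
by rewrite NegzE mulrNz mulNr -[LHS](pn n.+1) subrK.
Qed.

(** A translation of x by a multiple of L brings any point into the compact rectangle [0, L] x
    [-|K|, |K|], unless |v| > |K|, where f vanishes. The absolute value keeps the rectangle nonempty
    for negative K. *)
Lemma test_bounded f : test_function L f -> exists M, forall z, `|f z| <= M.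
Proof.
move=> [sf pf [K Kf]].
pose A : set (R * R) := `[0, L] `*` `[- `|K|, `|K|].
have cA : compact A by apply: compact_setX; exact: segment_compact.
have A0 : A !=set0.
  exists (0, 0); split; rewrite /= in_itv /= ?lexx ?(ltW L_gt0)//.
  by rewrite oppr_le0 normr_ge0.
have cf : {within A, continuous (fun z => `|f z|)}.
  apply: continuous_subspaceT => z; apply: cvg_norm.
  exact: smooth_continuous.
have [c Ac fc] := compact_EVT_max A0 cA cf.
exists `|f c| => -[x v]; have [vK|Kv] := leP `|v| `|K|; last first.
  by rewrite Kf ?normr0// (le_lt_trans (ler_norm _)).
pose k := Num.floor (x / L).
rewrite -(subrK (k%:~R * L) x) x_periodic_int//; apply: fc.
have /andP[k1 k2] := floor_itv (x / L).
rewrite inE; split; rewrite /= in_itv /=; last by rewrite -ler_norml.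
rewrite subr_ge0 -ler_pdivlMr// k1 /= lerBlDr.
move: k2; rewrite -/k intrD ltr_pdivrMr// mulrDl mul1r addrC => /ltW.
by rewrite addrC.
Qed.

Lemma test_measurable f : test_function L f -> measurable_fun setT f.
Proof.
by move=> [sf _ _]; apply: continuous_measurable_plane; exact: smooth_continuous.
Qed.

Lemma test_L2 f : test_function L f -> L2 L_gt0 f.
Proof.
move=> tf; have [M fM] := test_bounded tf.
exact: bounded_L2 (test_measurable tf) fM.
Qed.

End TestL2.

(** * Integrals against the phase measure *)

Section PhaseIntegrals.
Context {R : realType} {L : R} (L_gt0 : 0 < L).
Local Notation V := (R * R -> R).
Implicit Type h : V.
Local Notation m := (phase_measure L_gt0).
Local Notation leb := (@lebesgue_measure R).
Local Notation rho := (normal_pdf (0 : R) 1).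

Lemma integral_normal (F : R -> \bar R) : measurable_fun setT F ->
  (\int[normal_prob (0 : R) 1]_v F v = \int[leb]_v (F v * (rho v)%:E))%E.
Proof.
apply: (@integral_density _ _ _ leb (normal_prob (0 : R) 1) rho) => //.
  exact: measurable_normal_pdf.
by move=> v; exact: normal_pdf_ge0.
Qed.

(** The half-open interval, rather than the closed support of [uniform_pdf], matches the strip in
    [weak_derivative]. *)
Definition torus_pdf (x : R) : R := L^-1 * \1_`[0, L[ x.

Lemma torus_pdf_ge0 x : 0 <= torus_pdf x.
Proof. by rewrite mulr_ge0// invr_ge0 ltW. Qed.

Lemma measurable_torus_pdf : measurable_fun setT torus_pdf.
Proof. by apply: measurable_funM => //; exact: measurable_indic. Qed.

Lemma integral_torus (F : R -> \bar R) : measurable_fun setT F ->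
  (\int[uniform_prob L_gt0]_x F x = \int[leb]_x (F x * (torus_pdf x)%:E))%E.
Proof.
apply: (@integral_density _ _ _ leb (uniform_prob L_gt0) torus_pdf).
  exact: measurable_torus_pdf.
  exact: torus_pdf_ge0.
move=> A mA; rewrite /uniform_prob [LHS]integral_uniform_pdf.
rewrite setIC integral_mkcondr [RHS]integral_mkcond.
rewrite -integral_itv_bndo_bndc; last first.
  apply: measurable_funTS; apply: ((measurable_restrictT _ mA).1).
  apply: measurable_funTS; apply/measurable_EFinP.
  exact: measurable_uniform_pdf.
rewrite [LHS]integral_mkcond; apply: eq_integral => x _.
rewrite !patchE /torus_pdf indicE; case: (x \in A); last by case: ifP.
case: ifPn => xL; last by rewrite mulr0.
rewrite mulr1 /uniform_pdf subr0; move: xL.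
by rewrite inE /= in_itv /= => /andP[-> /ltW ->].
Qed.

Let dens (z : R * R) : R := torus_pdf z.1 * rho z.2.

Let dens_ge0 z : 0 <= dens z.
Proof. by rewrite mulr_ge0// ?torus_pdf_ge0// normal_pdf_ge0. Qed.

Let measurable_dens : measurable_fun setT dens.
Proof.
apply: measurable_funM.
  exact: (measurableT_comp measurable_torus_pdf).
exact: (measurableT_comp (measurable_normal_pdf _ _)).
Qed.

Lemma integral_phase (F : R * R -> \bar R) : measurable_fun setT F ->
  (\int[m]_z F z = \int[leb \x leb]_z (F z * (dens z)%:E))%E.
Proof.
move: F; apply: (@integral_density_ge0 _ _ _ (leb \x leb)%E m dens dens_ge0) => F mF F0.
have mF2 x : measurable_fun setT (fun v : R => F (x, v)).
  by apply: (measurableT_comp mF); exact: measurable_pair1.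
rewrite fubini_tonelli1//.
rewrite integral_torus; last first.
  have H := @measurable_fun_fubini_tonelli_F _ _ _ _ R (normal_prob (0 : R) 1) _ mF F0.
  exact: H.
rewrite [RHS]fubini_tonelli1; last 2 first.
- by apply: emeasurable_funM => //; apply/measurable_EFinP; exact: measurable_dens.
- by move=> z; rewrite mule_ge0// lee_fin.
apply: eq_integral => x _; rewrite /fubini_F integral_normal//.
rewrite muleC -ge0_integralZl//; last 3 first.
- apply: emeasurable_funM; first exact: mF2.
  by apply/measurable_EFinP; exact: measurable_normal_pdf.
- by move=> v _; rewrite mule_ge0// lee_fin normal_pdf_ge0.
- by rewrite lee_fin torus_pdf_ge0.
by apply: eq_integral => v _; rewrite /dens /= EFinM muleCA.
Qed.

(** The factor L undoes the normalisation of the measure of the torus. *)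
Lemma strip_integral h : m.-integrable setT (EFin \o h) ->
  \int[(leb \x leb)%E]_(z in `[0, L[ `*` setT) (h z * rho z.2) =
  L * \int[m]_z h z.
Proof.
move=> ih; rewrite -RintegralZl//.
have mh : measurable_fun setT h by apply/measurable_EFinP; exact: measurable_int ih.
rewrite /Rintegral; congr fine; rewrite integral_phase; last first.
  by apply/measurable_EFinP; exact: measurable_funM.
rewrite integral_mkcond; apply: eq_integral => -[x v] _.
rewrite patchE /dens /torus_pdf /= indicE.
have -> : ((x, v) \in `[0, L[ `*` setT) = (x \in `[0, L[%classic).
  by apply/idP/idP; rewrite !inE //= => -[].
case: ifP => _; last by rewrite mulr0 mul0r mule0.
rewrite mulr1 -EFinM; congr (_%:E); field.
by rewrite gt_eqF.
Qed.

End PhaseIntegrals.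

Section FTC.
Context {R : realType}.
Local Notation leb := (@lebesgue_measure R).
Context {F dF : R -> R}.
Context (dFP : forall t : R, is_derive t 1 F (dF t)) (cdF : continuous dF).

Lemma everywhere_derivable_continuous : continuous F.
Proof.
move=> t; apply/differentiable_continuous/derivable1_diffP.
by case: (dFP t).
Qed.

Lemma everywhere_FTC2 (a b : R) : a < b ->
  (\int[leb]_(x in `[a, b]) (dF x)%:E = (F b - F a)%:E)%E.
Proof.
move=> ab; rewrite (continuous_FTC2 (F := F) ab)//.
- exact: continuous_subspaceT.
- have cF := everywhere_derivable_continuous.
  split=> [x _||]; first by case: (dFP x).
    exact: cvg_at_right_filter (cF a).
  exact: cvg_at_left_filter (cF b).
- by move=> x _; rewrite derive1E; case: (dFP x).
Qed.

Lemma integral_compact_derivative (K : R) :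
  (forall t, K < `|t| -> F t = 0 /\ dF t = 0) ->
  (\int[leb]_x (dF x)%:E = 0)%E.
Proof.
move=> F0; pose k : R := `|K| + 1.
have kK (t : R) : k <= `|t| -> F t = 0 /\ dF t = 0.
  move=> kt; apply: F0; apply: lt_le_trans kt.
  by rewrite /k (le_lt_trans (ler_norm K))// ltrDl.
have k0 : 0 < k by rewrite /k ltr_wpDl.
transitivity (\int[leb]_(x in `[(- k)%R, k]) (dF x)%:E)%E.
  rewrite [RHS]integral_mkcond; apply: eq_integral => x _; rewrite patchE.
  case: ifPn => //; rewrite notin_setE /= in_itv /= -ler_norml => /negP.
  by rewrite -ltNge => /ltW /kK[_ ->].
rewrite everywhere_FTC2; last by lra.
have [-> _] := kK k (ler_norm k).
by have [|-> _] := kK (- k); rewrite ?normrN ?ler_norm// subrr.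
Qed.

End FTC.

(** * Integration by parts against the Gaussian weight *)

Section Exactness.
Context {R : realType} {L : R} (L_gt0 : 0 < L).
Local Notation V := (R * R -> R).
Implicit Types h psi : V.
Local Notation m := (phase_measure L_gt0).
Local Notation leb := (@lebesgue_measure R).
Local Notation rho := (normal_pdf (0 : R) 1).

Definition weight (z : R * R) : R := rho z.2.

Lemma weightE : weight = fun z => normal_peak (1 : R) * expR (- 2^-1 * (z.2 * z.2)).
Proof.
apply/funext => z; rewrite /weight normal_pdfE ?oner_eq0// /normal_fun.
by congr (_ * expR _); rewrite subr0 expr1n expr2; field.
Qed.

Lemma weight_neq0 z : weight z != 0.
Proof.
by rewrite weightE mulf_neq0 ?gt_eqF ?expR_gt0 ?normal_peak_gt0 ?oner_eq0.
Qed.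

Lemma smooth_weight : smooth weight.
Proof.
rewrite weightE; apply: (@smoothM _ (fun=> normal_peak (1 : R))).
  exact: smooth_cst.
exact: smooth_gauss.
Qed.

Lemma partial_weight b : partial b weight = fun z => - ((~~ b)%:R * z.2) * weight z.
Proof.
rewrite weightE (partialMs b (smooth_cst _) (smooth_gauss _)).
by rewrite partial_cst partial_gauss; apply/funext => z; field.
Qed.

(** Growth at infinity is harmless, since this function multiplies only functions of compact support
    in v. *)
Lemma smooth_weightV : smooth (fun z => (weight z)^-1).
Proof.
rewrite (_ : (fun z => _) =
    fun z => (normal_peak (1 : R))^-1 * expR (2^-1 * (z.2 * z.2))).
  apply: (@smoothM _ (fun=> (normal_peak (1 : R))^-1)); first exact: smooth_cst.
  exact: smooth_gauss.
by apply/funext => z; rewrite weightE invfM -expRN mulNr opprK.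
Qed.

(** In x, a derivative integrates to 0 over a period. In v, (d_v psi - v psi) rho is the derivative
    of psi rho, which has compact support. *)
Lemma integral_partial_weight b psi : test_function L psi ->
  \int[m]_z (partial b psi z - (~~ b)%:R * (z.2 * psi z)) = 0.
Proof.
move=> tpsi; pose h z := partial b psi z - (~~ b)%:R * (z.2 * psi z).
have th : test_function L h.
  by apply: testD; [exact: test_partial|apply: testN; exact/testZ/test_snd].
have ih : m.-integrable setT (EFin \o h) by exact/L2_integrable/test_L2.
have mh : measurable_fun setT h by exact: (test_measurable th).
rewrite /Rintegral -[LHS]/(fine (\int[m]_z (h z)%:E)).
suff -> : (\int[m]_z (h z)%:E = 0)%E by [].
have hx v : measurable_fun setT (fun x : R => (h (x, v))%:E).
  by apply/measurable_EFinP; apply: (measurableT_comp mh); exact: measurable_pair2.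
have hv x : measurable_fun setT (fun v : R => (h (x, v))%:E).
  by apply/measurable_EFinP; apply: (measurableT_comp mh); exact: measurable_pair1.
case: b @h th ih mh hx hv => h th ih mh hx hv.
  have hE : h = dx psi by apply/funext => z; rewrite /h mul0r subr0.
  rewrite -(integral21_prod_meas1 ih); apply: integral0_eq => v _.
  rewrite /fubini_G /= integral_torus//.
  have dF x := dx_is_derive x v (test_smooth tpsi).
  have cF : continuous (fun x => dx psi (x, v)).
    exact: (everywhere_derivable_continuous (fun x =>
      dx_is_derive x v (test_smooth (test_partial true tpsi)))).
  transitivity (\int[leb]_(x in `[0%R, L[) ((L^-1)%:E * (dx psi (x, v))%:E))%E.
    rewrite [RHS]integral_mkcond; apply: eq_integral => x _.
    rewrite patchE /torus_pdf indicE hE; case: ifP => _.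
      by rewrite mulr1 muleC.
    by rewrite mulr0 mule0.
  rewrite integral_itv_bndo_bndc; last first.
    apply: measurable_funTS; apply: emeasurable_funM => //.
    by have := hx v; rewrite hE.
  rewrite integralZl//; last first.
    apply: continuous_compact_integrable; first exact: segment_compact.
    exact: continuous_subspaceT.
  rewrite (everywhere_FTC2 dF cF L_gt0); case: tpsi => _ /(_ 0 v) + _.
  by rewrite add0r => ->; rewrite subrr mule0.
rewrite -(integral12_prod_meas1 ih); apply: integral0_eq => x _.
rewrite /fubini_F /= integral_normal//.
have spsi := test_smooth tpsi; have sW := smoothM spsi smooth_weight.
have WE : dv (fun z => psi z * weight z) = fun z => h z * weight z.
  rewrite -[LHS]/(partial false _) (partialMs false spsi smooth_weight).
  by rewrite partial_weight; apply/funext => z; rewrite /h /partial; ring.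
have dF v := dv_is_derive x v sW.
have cF : continuous (fun v => dv (fun z => psi z * weight z) (x, v)).
  exact: (everywhere_derivable_continuous (fun v =>
    dv_is_derive x v (smooth_partial false sW))).
transitivity (\int[leb]_v (dv (fun z => psi z * weight z) (x, v))%:E)%E.
  by apply: eq_integral => v _; rewrite WE EFinM.
have [_ _ [M Mpsi]] := tpsi; have [_ _ [M' Mh]] := th.
apply: (integral_compact_derivative dF cF (K := Num.max M M')) => v.
by rewrite gt_max WE => /andP[/Mpsi -> /Mh ->]; rewrite !mul0r.
Qed.

End Exactness.

(** * Weak derivatives and the space H^1 *)

Section WeakDerivatives.
Context {R : realType} {L : R} (L_gt0 : 0 < L).
Local Notation V := (R * R -> R).
Implicit Types f g h phi psi : V.
Local Notation m := (phase_measure L_gt0).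
Local Notation ip := (ip L_gt0).
Local Notation L2 := (L2 L_gt0).
Local Notation nL2 := (L2norm L_gt0).

Let linL2 := @L2_lin_closed _ _ L_gt0.
Let siL2 := @ip_semi_inner _ _ L_gt0.

(** The formal adjoint of [partial b] in L^2(dmu dnu): -d_x, or v - d_v because of the weight. *)
Definition adjoint b psi : V := fun z =>
  (~~ b)%:R * (z.2 * psi z) - partial b psi z.

Lemma test_adjoint b psi : test_function L psi -> test_function L (adjoint b psi).
Proof.
move=> tpsi; apply: testD; first exact/testZ/test_snd.
exact/testN/test_partial.
Qed.

Lemma ip_test_adjoint b phi psi : test_function L phi -> test_function L psi ->
  ip phi (adjoint b psi) = ip (partial b phi) psi.
Proof.
move=> tphi tpsi.
have := integral_partial_weight L_gt0 b (testMM tphi tpsi).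
rewrite (partialMs b (test_smooth tphi) (test_smooth tpsi)) => H.
have L1 := test_L2 L_gt0 tphi.
have L2' := test_L2 L_gt0 (test_adjoint b tpsi).
have L3 := test_L2 L_gt0 (test_partial b tphi).
have L4 := test_L2 L_gt0 tpsi.
apply/eqP; rewrite eq_sym -subr_eq0 -H /ip -RintegralB//; [|exact: L2_mul_integrable..].
by apply/eqP/eq_Rintegral => z _; rewrite /adjoint; ring.
Qed.

(** Weak derivatives are defined against Lebesgue measure; the substitution phi = psi rho, a
    bijection of test functions because rho and its inverse are smooth, turns the definition into
    duality in L^2(dmu dnu). *)
Lemma weak_derivativeP b f g : L2 f -> L2 g ->
  weak_derivative L (partial b) f g <->
  forall psi, test_function L psi -> ip f (adjoint b psi) = ip g psi.
Proof.
move=> f2 g2.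
have W0 := @weight_neq0 R.
have key psi : test_function L psi ->
    (\int[(lebesgue_measure \x lebesgue_measure)%E]_(z in `[0, L[ `*` setT)
      (f z * partial b (fun z => psi z * weight z) z) = - (L * ip f (adjoint b psi))) /\
    (\int[(lebesgue_measure \x lebesgue_measure)%E]_(z in `[0, L[ `*` setT)
      (g z * (psi z * weight z)) = L * ip g psi).
  move=> tpsi.
  have a2 := test_L2 L_gt0 (test_adjoint b tpsi); have p2 := test_L2 L_gt0 tpsi.
  split; last first.
    rewrite -(strip_integral (L2_mul_integrable g2 p2)).
    by apply: eq_Rintegral => z _; rewrite mulrA.
  have i1 := L2_mul_integrable f2 (test_L2 L_gt0 (testN (test_adjoint b tpsi))).
  rewrite (_ : - _ = L * \int[m]_z (f z * - adjoint b psi z)); last first.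
    rewrite -mulrN; congr (_ * _); rewrite -[LHS]mulN1r /ip.
    rewrite -RintegralZl//; last exact: L2_mul_integrable.
    by apply: eq_Rintegral => z _; ring.
  rewrite -(strip_integral i1).
  rewrite (partialMs b (test_smooth tpsi) (@smooth_weight R)) partial_weight.
  by apply: eq_Rintegral => z _; rewrite /adjoint /weight; ring.
have Ln0 : L != 0 by rewrite gt_eqF.
have testW psi : test_function L psi -> test_function L (fun z => psi z * weight z).
  by move=> tpsi; apply: testM => //; exact: smooth_weight.
split=> [wd psi tpsi|H phi tphi].
  have [E1 E2] := key _ tpsi; have := wd _ (testW _ tpsi).
  by rewrite E1 E2 => /oppr_inj/(mulfI Ln0).
have tpsi : test_function L (fun z => phi z * (weight z)^-1).
  by apply: testM => //; exact: smooth_weightV.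
have [E1 E2] := key _ tpsi; move: E1 E2.
have -> : (fun z => phi z * (weight z)^-1 * weight z) = phi.
  by apply/funext => z; rewrite divfK.
move=> -> E2; rewrite (H _ tpsi) -E2; congr (- _).
by apply: eq_Rintegral => z _; rewrite divfK.
Qed.

Lemma test_weak_derivative b phi : test_function L phi ->
  L2_derivatives L_gt0 (partial b) phi (partial b phi).
Proof.
move=> tphi; have d2 := test_L2 L_gt0 (test_partial b tphi); split=> //.
apply/weak_derivativeP => //; first exact: test_L2.
by move=> psi tpsi; exact: ip_test_adjoint.
Qed.

Lemma L2_derivatives_lin b a f f' g g' : L2 f -> L2 g ->
  L2_derivatives L_gt0 (partial b) f f' -> L2_derivatives L_gt0 (partial b) g g' ->
  L2_derivatives L_gt0 (partial b) (lin a f g) (lin a f' g').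
Proof.
move=> f2 g2 [f'2 wf] [g'2 wg]; split; first exact: linL2.
apply/weak_derivativeP; [exact: linL2|exact: linL2|move=> psi tpsi].
have p2 := test_L2 L_gt0 tpsi; have a2 := test_L2 L_gt0 (test_adjoint b tpsi).
rewrite !(si_lin siL2)//.
by rewrite ((weak_derivativeP _ f2 f'2).1 wf)// ((weak_derivativeP _ g2 g'2).1 wg).
Qed.

Lemma H1P f : H1 L_gt0 f <->
  L2 f /\ forall b, L2_derivatives L_gt0 (partial b) f !=set0.
Proof.
split=> [[f2 fx fv]|[f2 fb]].
  by split; [exact: f2|case; [exact: fx|exact: fv]].
by split; [exact: f2|exact: (fb true)|exact: (fb false)].
Qed.

Lemma H1_lin_closed : lin_closed (H1 L_gt0).
Proof.
move=> a f g /H1P[f2 f'] /H1P[g2 g']; apply/H1P; split; first exact: linL2.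
move=> b; have [u fu] := f' b; have [w gw] := g' b.
by exists (lin a u w); exact: L2_derivatives_lin.
Qed.

Lemma test_H1 phi : test_function L phi -> H1 L_gt0 phi.
Proof.
move=> tphi; apply/H1P; split; first exact: test_L2.
by move=> b; exists (partial b phi); exact: test_weak_derivative.
Qed.

Definition gradient b f : V := weak_d L_gt0 (partial b) f.

Lemma gradientP b f : H1 L_gt0 f -> L2_derivatives L_gt0 (partial b) f (gradient b f).
Proof. by move=> /H1P[_ /(_ b)[g fg]]; exact: (xgetI (cst 0) fg). Qed.

Lemma gradient_L2 b f : H1 L_gt0 f -> L2 (gradient b f).
Proof. by move=> /(gradientP b)[]. Qed.

(** Equality of classes, the only sense in which a chosen weak derivative respects linear
    combinations. *)
Definition L2eq f g := [/\ L2 f, L2 g & nL2 (f \- g) = 0].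

Lemma ip_L2eq f f' g : L2eq f f' -> L2 g -> ip f g = ip f' g.
Proof.
move=> [f2 f'2 ff'] g2; apply/eqP; rewrite -subr_eq0 -(si_subl siL2)//.
by rewrite ip_eq0//; exact: sub_closed linL2 _ _ _ _.
Qed.

Lemma ip_L2eq2 f f' g g' : L2eq f f' -> L2eq g g' -> ip f g = ip f' g'.
Proof.
move=> ff' gg'; case: (ff') (gg') => f2 f'2 _ [g2 g'2 _].
by rewrite (ip_L2eq ff')// !(si_sym siL2 f'2)//; exact: ip_L2eq.
Qed.

(** [D] will be a chosen weak derivative, the sum of both, the centring or the mean; linearity of
    [D] up to [L2eq] is enough for this form to be bilinear. *)
Definition pullback (D : V -> V) f g := ip (D f) (D g).

Section Pullback.
Context {X : set V} {D : V -> V}.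
Context (DL2 : forall f, X f -> L2 (D f)).
Context (linX : lin_closed X).
Context (Dlin : forall a f g, X f -> X g -> L2eq (D (lin a f g)) (lin a (D f) (D g))).

Lemma pullback_semi_inner : semi_inner X (pullback D).
Proof.
split=> [f g Xf Xg|a f g h Xf Xg Xh|f Xf]; rewrite /pullback.
- by rewrite (si_sym siL2)//; exact: DL2.
- rewrite (ip_L2eq (Dlin a Xf Xg)); last exact: DL2.
  by rewrite (si_lin siL2)//; exact: DL2.
- by apply: (si_ge0 siL2); exact: DL2.
Qed.

End Pullback.

Section Dense.
Context (dense : forall f (e : R), L2 f -> 0 < e ->
  exists2 psi, test_function L psi & nL2 (psi \- f) < e).

(** If psi is within e of f, then |f|^2 = - <f, psi - f> <= |f| e. *)
Lemma ip_test_eq0 f : L2 f -> (forall psi, test_function L psi -> ip f psi = 0) ->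
  nL2 f = 0.
Proof.
move=> f2 f0; have n0 : 0 <= nL2 f by rewrite L2normE// sqrtr_ge0.
apply/eqP; rewrite eq_le n0 andbT; apply/ler_addgt0Pr => e e0; rewrite add0r.
have [psi tpsi psif] := dense f2 e0; have p2 := test_L2 L_gt0 tpsi.
have d2 : L2 (psi \- f) by exact: (sub_closed linL2).
have E : ip f f = - ip f (psi \- f).
  by rewrite (si_subr linL2 siL2)// (f0 psi tpsi) sub0r opprK.
have : nL2 f ^+ 2 <= nL2 f * e.
  rewrite L2normE// sqr_sqrtr ?(si_ge0 siL2)// E.
  apply: (le_trans (ler_norm _)); rewrite normrN.
  apply: (le_trans (le_snorm linL2 siL2 f2 d2)).
  by rewrite ler_wpM2l ?sqrtr_ge0// -L2normE// ltW.
move: n0; rewrite le_eqVlt => /predU1P[<- _|n0]; first exact: ltW.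
by rewrite expr2 ler_pM2l.
Qed.

Lemma weak_derivative_unique b f g g' : L2 f ->
  L2_derivatives L_gt0 (partial b) f g -> L2_derivatives L_gt0 (partial b) f g' ->
  L2eq g g'.
Proof.
move=> f2 [g2 wg] [g'2 wg']; split=> //.
apply: ip_test_eq0; first exact: (sub_closed linL2).
move=> psi tpsi; rewrite (si_subl siL2)//; last exact: test_L2.
rewrite -((weak_derivativeP _ f2 g2).1 wg)//.
by rewrite -((weak_derivativeP _ f2 g'2).1 wg')// subrr.
Qed.

Lemma gradient_eq b f g : L2_derivatives L_gt0 (partial b) f g -> H1 L_gt0 f ->
  L2eq (gradient b f) g.
Proof.
move=> fg f1; apply: weak_derivative_unique fg; last exact: gradientP.
by case: f1.
Qed.

Lemma gradient_test b phi : test_function L phi ->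
  L2eq (gradient b phi) (partial b phi).
Proof.
by move=> tphi; apply: gradient_eq; [exact: test_weak_derivative|exact: test_H1].
Qed.

Lemma gradient_lin b a f g : H1 L_gt0 f -> H1 L_gt0 g ->
  L2eq (gradient b (lin a f g)) (lin a (gradient b f) (gradient b g)).
Proof.
move=> f1 g1; apply: gradient_eq; last exact: H1_lin_closed.
by apply: L2_derivatives_lin; [case: f1|case: g1|exact: gradientP|exact: gradientP].
Qed.

End Dense.
End WeakDerivatives.

(** * Poincare inequalities on an interval and on the Gaussian line *)

Section Poincare1D.
Context {R : realType}.
Local Notation leb := (@lebesgue_measure R).
Local Notation rho := (normal_pdf (0 : R) 1).

Lemma is_derive_mul (f g : R -> R) (t df dg : R) :
  is_derive t 1 f df -> is_derive t 1 g dg ->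
  is_derive t 1 (fun s => f s * g s) (df * g t + f t * dg).
Proof.
move=> hf hg; apply: (is_derive_eq (is_deriveM hf hg)).
by rewrite /GRing.scale /= addrC (mulrC (g t)).
Qed.

Lemma is_derive_scale (c : R) (f : R -> R) (t df : R) :
  is_derive t 1 f df -> is_derive t 1 (fun s => c * f s) (c * df).
Proof. by move=> hf; exact: (is_deriveZ c hf). Qed.

Lemma continuous_sqr (F : R -> R) : continuous F -> continuous (fun t => F t ^+ 2).
Proof. by move=> cF t; exact: (cvgM (cF t) (cF t)). Qed.

Lemma continuous_measurable_EFin (F : R -> R) (D : set R) : continuous F ->
  measurable_fun D (EFin \o F).
Proof.
move=> cF; apply: measurable_funTS; apply/measurable_EFinP.
exact: continuous_measurable_fun.
Qed.

(** The derivative of H integrates to a nonnegative number, so each Poincare inequality reduces to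
    finding an H that satisfies the pointwise bound. *)
Lemma integral_le_FTC (H dH p q : R -> R) (C a b : R) : a < b -> 0 <= C ->
  (forall t : R, is_derive t 1 H (dH t)) -> continuous dH ->
  continuous p -> continuous q -> (forall t, 0 <= p t) -> (forall t, 0 <= q t) ->
  (forall t, a <= t <= b -> p t <= C * q t - dH t) -> H a <= H b ->
  (\int[leb]_(t in `[a, b]) (p t)%:E <=
   C%:E * \int[leb]_(t in `[a, b]) (q t)%:E)%E.
Proof.
move=> ab C0 dHP cdH cp cq p0 q0 le_pq Hab.
have int (F : R -> R) : continuous F -> leb.-integrable `[a, b] (EFin \o F).
  move=> cF; apply: continuous_compact_integrable; first exact: segment_compact.
  exact: continuous_subspaceT.
have cCq : continuous (fun t => C * q t).
  by move=> t; apply: cvgM; [exact: cvg_cst|exact: cq].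
have cr : continuous (fun t => C * q t - dH t).
  by move=> t; apply: cvgB; [exact: cCq|exact: cdH].
apply: (@le_trans _ _ (\int[leb]_(t in `[a, b]) (C * q t - dH t)%:E)%E).
  apply: le_integral => //; [exact: int p cp|exact: int _ cr|move=> t].
  by rewrite inE /= in_itv /= => tab; rewrite lee_fin le_pq.
have -> : (\int[leb]_(t in `[a, b]) (C * q t - dH t)%:E =
    \int[leb]_(t in `[a, b]) (C * q t)%:E - \int[leb]_(t in `[a, b]) (dH t)%:E)%E.
  by rewrite integralB_EFin//; exact: int.
rewrite (everywhere_FTC2 dHP cdH ab).
under eq_integral do rewrite EFinM.
rewrite integralZl//; last exact: int.
by rewrite leeBlDr//= leeDl// lee_fin subr_ge0.
Qed.

Context {G dG : R -> R}.
Context (dGP : forall t : R, is_derive t 1 G (dG t)) (cdG : continuous dG).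

Let g t := G t - G 0.

Let dg (t : R) : is_derive t 1 g (dG t).
Proof.
by apply: (is_derive_eq (is_deriveB (dGP t) (is_derive_cst (G 0) t 1)));
  rewrite subr0.
Qed.

Let cg : continuous g. Proof. exact: everywhere_derivable_continuous dg. Qed.

Let dg2 (t : R) : is_derive t 1 (fun t => g t * g t) (2 * (g t * dG t)).
Proof.
by apply: (is_derive_eq (is_derive_mul (dg t) (dg t))); ring.
Qed.

Lemma torus_poincare_at0 (L : R) (L_gt0 : 0 < L) :
  (\int[uniform_prob L_gt0]_t (g t ^+ 2)%:E <=
   (4 * L ^+ 2)%:E * \int[uniform_prob L_gt0]_t (dG t ^+ 2)%:E)%E.
Proof.
have sq0 (F : R -> R) (t : R) : (0 <= (F t ^+ 2)%:E)%E by rewrite lee_fin sqr_ge0.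
rewrite !integral_uniform//; try exact: (continuous_measurable_EFin (continuous_sqr _)).
rewrite muleCA lee_wpmul2l ?lee_fin ?invr_ge0 ?subr0 ?(ltW L_gt0)//.
(* H vanishes at both ends of [0, L]; integrating its derivative and using
   Young's inequality for the cross term gives the bound. *)
pose H (t : R) := 2 * ((L - t) * (g t * g t)).
pose dH (t : R) := 2 * (- (g t * g t) + (L - t) * (2 * (g t * dG t))).
have dHP (t : R) : is_derive t 1 H (dH t).
  have d1 : is_derive t 1 (fun t : R => L - t) (- 1).
    by apply: (is_derive_eq (is_deriveB (is_derive_cst L t 1) (is_derive_id t 1)));
      rewrite sub0r.
  apply: (is_derive_eq (is_derive_scale 2 (is_derive_mul d1 (dg2 t)))).
  by rewrite /dH; ring.
apply: (integral_le_FTC L_gt0 _ dHP) => //.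
- by rewrite mulr_ge0// sqr_ge0.
- move=> t; rewrite /dH; apply: cvgM; first exact: cvg_cst.
  have cL : (fun t : R => L - t) x @[x --> t] --> L - t.
    by apply: cvgB; [exact: cvg_cst|exact: cvg_id].
  apply: cvgD; first by apply: cvgN; apply: cvgM; exact: cg.
  apply: cvgM => //; apply: cvgM; first exact: cvg_cst.
  by apply: cvgM; [exact: cg|exact: cdG].
- exact: continuous_sqr.
- exact: continuous_sqr.
- by move=> t; exact: sqr_ge0.
- by move=> t; exact: sqr_ge0.
- move=> t /andP[t0 tL]; rewrite /dH; move: (g t) (dG t) => u w.
  have h : (L - t) ^+ 2 <= L ^+ 2 by rewrite ler_sqr ?nnegrE; lra.
  (* Expanding this square gives the bound; the constant 4 L^2 dominates (2 (L - t))^2. *)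
  have : 0 <= (u - 2 * (L - t) * w) ^+ 2 by exact: sqr_ge0.
  have : (L - t) ^+ 2 * w ^+ 2 <= L ^+ 2 * w ^+ 2 by rewrite ler_wpM2r ?sqr_ge0.
  by nra.
- by rewrite /H /g !subrr; lra.
Qed.

Lemma is_derive_normal_pdf (v : R) : is_derive v 1 rho (- (v * rho v)).
Proof.
have := dv_is_derive 0 v (@smooth_weight R).
rewrite -[dv weight]/(partial false weight) partial_weight /weight /=.
by move=> h; apply: (is_derive_eq h); ring.
Qed.

Let gauss_half (s a b : R) : s ^+ 2 = 1 -> a < b ->
  (forall t, a <= t <= b -> 0 <= s * t) ->
  s * (g a * g a) <= 0 -> 0 <= s * (g b * g b) ->
  (\int[leb]_(t in `[a, b]) (g t ^+ 2 * rho t)%:E <=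
   16%:E * \int[leb]_(t in `[a, b]) (dG t ^+ 2 * rho t)%:E)%E.
Proof.
move=> s2 ab st0 Ha Hb.
(* On the half line s t >= 0 the weight w = s (1 + exp (- s t)) satisfies
   w' - t w <= - 1, so that (w g^2 rho)' controls g^2 rho. *)
pose e (t : R) := expR (- s * t).
have de (t : R) : is_derive t 1 e (- s * e t).
  have d1 : is_derive t 1 (fun t : R => - s * t) (- s).
    by apply: (is_derive_eq (is_derive_scale (- s) (is_derive_id t 1))); rewrite mulr1.
  by rewrite mulrC; exact: (is_derive1_comp (is_derive_expR _) d1).
have dw (t : R) : is_derive t 1 (fun t => 1 + e t) (- s * e t).
  by apply: (is_derive_eq (is_deriveD (is_derive_cst (1 : R) t 1) (de t))); rewrite add0r.
pose H (t : R) := 2 * s * ((1 + e t) * ((g t * g t) * rho t)).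
pose dH (t : R) := 2 * s * ((- s * e t) * ((g t * g t) * rho t) +
  (1 + e t) * (2 * (g t * dG t) * rho t + (g t * g t) * - (t * rho t))).
have dHP (t : R) : is_derive t 1 H (dH t).
  exact: (is_derive_scale (2 * s) (is_derive_mul (dw t)
    (is_derive_mul (dg2 t) (is_derive_normal_pdf t)))).
have crho : continuous rho by apply: continuous_normal_pdf; rewrite oner_eq0.
have ce : continuous e := everywhere_derivable_continuous de.
have cw : continuous (fun t => 1 + e t) := everywhere_derivable_continuous dw.
have rho0 t : 0 <= rho t by exact: normal_pdf_ge0.
have H0 t : (0 <= s * (g t * g t) -> 0 <= H t) /\ (s * (g t * g t) <= 0 -> H t <= 0).
  have E : H t = (2 * (1 + e t) * rho t) * (s * (g t * g t)) by rewrite /H; ring.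
  have w0 : 0 <= 2 * (1 + e t) * rho t.
    by rewrite mulr_ge0// mulr_ge0// addr_ge0// expR_ge0.
  by rewrite E; split=> h; [rewrite mulr_ge0|rewrite mulr_ge0_le0].
apply: (integral_le_FTC ab _ dHP) => //.
- move=> t; rewrite /dH; apply: cvgM; first exact: cvg_cst.
  apply: cvgD; apply: cvgM.
  + by apply: cvgM; [exact: cvg_cst|exact: ce].
  + by apply: cvgM; [apply: cvgM; exact: cg|exact: crho].
  + exact: cw.
  + apply: cvgD; apply: cvgM.
    * by apply: cvgM; [exact: cvg_cst|apply: cvgM; [exact: cg|exact: cdG]].
    * exact: crho.
    * by apply: cvgM; exact: cg.
    * by apply: cvgN; apply: cvgM; [exact: cvg_id|exact: crho].
- by move=> t; apply: cvgM; [exact: (continuous_sqr cg)|exact: crho].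
- by move=> t; apply: cvgM; [exact: (continuous_sqr cdG)|exact: crho].
- by move=> t; rewrite mulr_ge0// sqr_ge0.
- by move=> t; rewrite mulr_ge0// sqr_ge0.
- move=> t /st0 st; rewrite /dH.
  have e1 : 1 - s * t <= e t by rewrite -mulNr; exact: expR_ge1Dx.
  have e_le1 : e t <= 1 by rewrite /e -[leRHS]expR0 ler_expR mulNr oppr_le0.
  have e0 : 0 <= e t by exact: expR_ge0.
  move: (e t) (g t) (dG t) (rho0 t) e1 e_le1 e0 => d u w r0 d1 d_le1 d0.
  (* With A = d + s t (1 + d) and B = s (1 + d), A >= 1 follows from d >= 1 - s t, so the u^2 terms
     leave at least u^2; then (u - 2 B w)^2 >= 0 and |B| <= 2 account for 16 = (2 * 2)^2. *)
  rewrite -subr_ge0 (_ : _ - _ = (16 * w ^+ 2 - u ^+ 2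
      + 2 * u ^+ 2 * (s ^+ 2 * d + (s * t) * (1 + d))
      - 4 * (s * (1 + d)) * (u * w)) * rho t); last by ring.
  rewrite mulr_ge0// s2 mul1r.
  have h1 : 1 <= d + (s * t) * (1 + d) by nra.
  have h2 : u ^+ 2 <= u ^+ 2 * (d + (s * t) * (1 + d)).
    by rewrite ler_peMr ?sqr_ge0.
  have h3 : 0 <= (u - 2 * (s * (1 + d)) * w) ^+ 2 by exact: sqr_ge0.
  have h4 : (s * (1 + d)) ^+ 2 <= 4 by rewrite exprMn s2 mul1r; nra.
  have h5 : (s * (1 + d)) ^+ 2 * w ^+ 2 <= 4 * w ^+ 2.
    by rewrite ler_wpM2r ?sqr_ge0.
  move: h2 h3 h5; move: (d + s * t * (1 + d)) (s * (1 + d)) => A B.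
  by nra.
- have [_ /(_ Ha) h1] := H0 a; have [/(_ Hb) h2 _] := H0 b.
  exact: le_trans h1 h2.
Qed.

Let cp : continuous (fun t => g t ^+ 2 * rho t).
Proof.
have crho : continuous rho by apply: continuous_normal_pdf; rewrite oner_eq0.
by move=> t; apply: cvgM; [exact: (continuous_sqr cg)|exact: crho].
Qed.

Let cq : continuous (fun t => dG t ^+ 2 * rho t).
Proof.
have crho : continuous rho by apply: continuous_normal_pdf; rewrite oner_eq0.
by move=> t; apply: cvgM; [exact: (continuous_sqr cdG)|exact: crho].
Qed.

Let split_half (F : R -> R) (k : R) : continuous F -> (forall t, 0 <= F t) -> 0 < k ->
  (\int[leb]_(t in `[(- k)%R, k]) (F t)%:E =
   \int[leb]_(t in `[(- k)%R, 0%R]) (F t)%:E + \int[leb]_(t in `[0%R, k]) (F t)%:E)%E.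
Proof.
move=> cF F0 k0.
have mF (D : set R) : measurable_fun D (fun t => (F t)%:E) by exact: continuous_measurable_EFin.
rewrite (@itv_bndbnd_setU _ _ _ (BRight 0)); last 2 first.
- by rewrite bnd_simp oppr_le0 ltW.
- by rewrite bnd_simp ltW.
rewrite ge0_integral_setU//=.
- by rewrite integral_itv_obnd_cbnd.
- exact: mF.
- by move=> x _; rewrite lee_fin.
- apply/disj_setPS => y [/=]; rewrite !in_itv/= => /andP[_ y0] /andP[].
  by rewrite ltNge y0.
Qed.

(** Since [g] vanishes at 0, the boundary terms have the right sign on each half of [-n - 1, n + 1];
    monotone convergence then removes the cutoff. *)
Lemma gauss_poincare_at0 :
  (\int[normal_prob (0 : R) 1]_t (g t ^+ 2)%:E <=
   16%:E * \int[normal_prob (0 : R) 1]_t (dG t ^+ 2)%:E)%E.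
Proof.
rewrite !integral_normal; [|exact: (continuous_measurable_EFin (continuous_sqr _))..].
under eq_integral do rewrite -EFinM.
under [X in (_ <= _ * X)%E]eq_integral do rewrite -EFinM.
have rho0 t : 0 <= rho t by exact: normal_pdf_ge0.
have p0 t : 0 <= g t ^+ 2 * rho t by rewrite mulr_ge0// sqr_ge0.
have q0 t : 0 <= dG t ^+ 2 * rho t by rewrite mulr_ge0// sqr_ge0.
pose I n : set R := `[(- n.+1%:R)%R, n.+1%:R]%classic.
have IT : \bigcup_n I n = setT.
  apply/seteqP; split=> // t _; exists (Num.truncn `|t|) => //.
  by rewrite /I /= in_itv /= -ler_norml ltW// truncnS_gt.
have ndI : nondecreasing_seq I.
  move=> i k ik; apply/subsetPset; apply: subset_itv; rewrite bnd_simp.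
    by rewrite lerN2 ler_nat.
  by rewrite ler_nat.
have mI i : measurable (I i) by exact: measurable_itv.
have mfI i : measurable_fun (I i) (fun t => (g t ^+ 2 * rho t)%:E).
  exact: (continuous_measurable_EFin cp).
have fI0 i x : I i x -> (0 <= (g x ^+ 2 * rho x)%:E)%E by rewrite lee_fin.
have cvI := ge0_nondecreasing_set_cvg_integral (mu := leb) ndI mI mfI fI0.
rewrite IT in cvI; rewrite -(cvg_lim _ cvI)//.
- apply: lime_le.
    by apply/cvg_ex; eexists; exact: cvI.
  apply: nearW => n.
  have n0 : 0 < n.+1%:R :> R by [].
  rewrite /I (split_half cp p0 n0).
  apply: (@le_trans _ _ (16%:E * \int[leb]_(t in I n) (dG t ^+ 2 * rho t)%:E)%E).
    rewrite /I (split_half cq q0 n0) ge0_muleDr//; last 2 first.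
    + by apply: integral_ge0 => t _; rewrite lee_fin.
    + by apply: integral_ge0 => t _; rewrite lee_fin.
    apply: leeD.
      apply: (@gauss_half (-1)) => //.
      + by rewrite sqrrN expr1n.
      + by move=> t /andP[_ t0]; rewrite mulN1r oppr_ge0.
      + by rewrite mulN1r oppr_le0 -expr2 sqr_ge0.
      + by rewrite /g subrr !mul0r mulr0.
    apply: (@gauss_half 1) => //.
    + by rewrite expr1n.
    + by move=> t /andP[t0 _]; rewrite mul1r.
    + by rewrite /g subrr !mul0r mulr0.
    + by rewrite mul1r -expr2 sqr_ge0.
  rewrite lee_wpmul2l//; apply: ge0_subset_integral => //.
  + exact: mI.
  + exact: (continuous_measurable_EFin cq).
  + by move=> t _; rewrite lee_fin.
Qed.

End Poincare1D.

(** * Variances and the Poincare inequality of the phase measure *)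

Section BoundedMeasurable.
Context d (T : measurableType d) {R : realType}.

(** A class that contains the test functions, is stable under slices, averages, differences and
    squares, and is integrable for every probability. *)
Definition bounded_measurable (h : T -> R) :=
  measurable_fun setT h /\ exists M, forall x, `|h x| <= M.

Lemma bounded_measurable_cst c : bounded_measurable (fun=> c).
Proof. by split; [exact: measurable_cst|exists `|c|]. Qed.

Lemma bounded_measurableB h k : bounded_measurable h -> bounded_measurable k ->
  bounded_measurable (fun x => h x - k x).
Proof.
move=> [mh [M hM]] [mk [K kK]]; split; first exact: measurable_funB.
exists (M + K) => x; rewrite (le_trans (ler_normB _ _))// lerD//.
Qed.

Lemma bounded_measurable_sqr h : bounded_measurable h ->
  bounded_measurable (fun x => h x ^+ 2).
Proof.
move=> [mh [M hM]]; split; first exact: measurable_funX.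
by exists (M ^+ 2) => x; rewrite normrX ler_sqr ?nnegrE ?(le_trans _ (hM x)).
Qed.

Context (P : probability T R).

Lemma bounded_measurable_integrable h : bounded_measurable h ->
  P.-integrable setT (EFin \o h).
Proof.
move=> [mh [M hM]]; apply: measurable_bounded_integrable => //.
  by rewrite [X in (X < _)%E]probability_setT ltry.
exists M; split; first exact: num_real.
by move=> N MN x _ /=; rewrite (le_trans (hM x))// ltW.
Qed.

Lemma Rintegral_prob_cst (c : R) : \int[P]_x c = c.
Proof. by rewrite Rintegral_cst// [X in fine X]probability_setT mulr1. Qed.

Lemma Rintegral_sqr_sub h (t : R) : bounded_measurable h ->
  \int[P]_x (h x - t) ^+ 2 = \int[P]_x (h x ^+ 2) - 2 * t * \int[P]_x h x + t ^+ 2.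
Proof.
move=> bh; have ih := bounded_measurable_integrable bh.
have ih2 := bounded_measurable_integrable (bounded_measurable_sqr bh).
have ic := bounded_measurable_integrable (bounded_measurable_cst (t ^+ 2)).
have ith : P.-integrable setT (EFin \o (fun x => 2 * t * h x)).
  by have := integrableZl measurableT (2 * t) ih.
have isub : P.-integrable setT (EFin \o (fun x => h x ^+ 2 - 2 * t * h x)).
  by have := integrableB measurableT ih2 ith.
rewrite -[X in _ + X](Rintegral_prob_cst (t ^+ 2)) -RintegralZl// -RintegralB//.
rewrite -RintegralD//.
by apply: eq_Rintegral => x _; ring.
Qed.

(** The mean minimises the quadratic deviation: the two sides differ by the square of the mean minus
    [t]. *)
Lemma Rintegral_sqr_le h (t : R) : bounded_measurable h ->
  \int[P]_x (h x ^+ 2) <= (\int[P]_x h x) ^+ 2 + \int[P]_x (h x - t) ^+ 2.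
Proof.
move=> bh; rewrite Rintegral_sqr_sub// -subr_ge0.
rewrite (_ : _ - _ = (\int[P]_x h x - t) ^+ 2); first exact: sqr_ge0.
by ring.
Qed.

Lemma sqr_Rintegral_le h : bounded_measurable h ->
  (\int[P]_x h x) ^+ 2 <= \int[P]_x (h x ^+ 2).
Proof.
move=> bh; set t := \int[P]_x h x.
have : 0 <= \int[P]_x (h x - t) ^+ 2 by apply: Rintegral_ge0 => x _; exact: sqr_ge0.
by rewrite Rintegral_sqr_sub// -/t; lra.
Qed.

Lemma normr_Rintegral_le h M : bounded_measurable h -> (forall x, `|h x| <= M) ->
  `|\int[P]_x h x| <= M.
Proof.
move=> bh hM; apply: (le_trans (le_normr_Rintegral _ (bounded_measurable_integrable bh))) => //.
rewrite -[leRHS](Rintegral_prob_cst M); apply: le_Rintegral => //.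
  by have := integrable_abse (bounded_measurable_integrable bh).
exact: (bounded_measurable_integrable (bounded_measurable_cst M)).
Qed.

End BoundedMeasurable.

Section PhasePoincare.
Context {R : realType} {L : R} (L_gt0 : 0 < L).
Local Notation V := (R * R -> R).
Implicit Types f h : V.
Local Notation m := (phase_measure L_gt0).
Local Notation m1 := (uniform_prob L_gt0).
Local Notation m2 := (normal_prob (0 : R) 1).

Lemma bounded_measurable_x h v : bounded_measurable h ->
  bounded_measurable (fun x => h (x, v)).
Proof.
move=> [mh [M hM]]; split; last by exists M.
by apply: (measurableT_comp mh); exact: measurable_pair2.
Qed.

Lemma bounded_measurable_average h : bounded_measurable h ->
  bounded_measurable (fun v => \int[m1]_x h (x, v)).
Proof.
move=> bh; have [_ [M hM]] := bh; split; last first.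
  exists M => v; apply: normr_Rintegral_le; first exact: bounded_measurable_x.
  by move=> x; exact: hM.
have ih : m.-integrable setT (EFin \o h) by exact: bounded_measurable_integrable.
have mG : measurable_fun setT (fubini_G m1 (EFin \o h)) by exact: measurable_fubini_G ih.
by apply: (measurableT_comp _ mG); exact: fine_measurable.
Qed.

Lemma Rintegral_phase h : bounded_measurable h ->
  \int[m]_z h z = \int[m2]_v \int[m1]_x h (x, v).
Proof.
move=> bh; rewrite /Rintegral; congr fine.
have ih : m.-integrable setT (EFin \o h) by exact: bounded_measurable_integrable.
rewrite -(integral21_prod_meas1 ih); apply: eq_integral => v _.
rewrite /fubini_G fineK//; apply: integrable_fin_num => //.
exact: (bounded_measurable_integrable m1 (bounded_measurable_x v bh)).
Qed.

(** The law of total variance with the average [a] in x. The variance in x at fixed v is at most the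
    deviation from f(0, v); that of [a] is at most its deviation from [a 0], which Jensen's
    inequality bounds by the deviation of f from f(x, 0). *)
Lemma variance_phase_le f : bounded_measurable f ->
  bounded_measurable (fun z : R * R => f (0, z.2)) ->
  bounded_measurable (fun z : R * R => f (z.1, 0)) ->
  \int[m]_z (f z ^+ 2) <= (\int[m]_z f z) ^+ 2
    + \int[m]_z (f z - f (z.1, 0)) ^+ 2 + \int[m]_z (f z - f (0, z.2)) ^+ 2.
Proof.
move=> bf bf1 bf2; pose a v := \int[m1]_x f (x, v).
have ba : bounded_measurable a by exact: bounded_measurable_average.
have bfx := bounded_measurable_sqr (bounded_measurableB bf bf1).
have bfv := bounded_measurable_sqr (bounded_measurableB bf bf2).
have bf_sq := bounded_measurable_sqr bf.
have int2 := @bounded_measurable_integrable _ _ R m2.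
rewrite !Rintegral_phase//= -/a.
have le_x : \int[m2]_v (\int[m1]_x (f (x, v) ^+ 2)) <=
    \int[m2]_v (a v ^+ 2) + \int[m2]_v (\int[m1]_x (f (x, v) - f (0, v)) ^+ 2).
  rewrite -RintegralD//; last 2 first.
  - exact: (int2 _ (bounded_measurable_sqr ba)).
  - exact: (int2 _ (bounded_measurable_average bfx)).
  apply: le_Rintegral => //.
  - exact: (int2 _ (bounded_measurable_average bf_sq)).
  - have := integrableD measurableT (int2 _ (bounded_measurable_sqr ba))
      (int2 _ (bounded_measurable_average bfx)).
    by apply.
  - move=> v _; exact: (Rintegral_sqr_le m1 (f (0, v)) (bounded_measurable_x v bf)).
apply: (le_trans le_x); rewrite lerD2r.
apply: (le_trans (Rintegral_sqr_le m2 (a 0) ba)); rewrite lerD2l.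
apply: le_Rintegral => //.
- exact: (int2 _ (bounded_measurable_sqr (bounded_measurableB ba
    (@bounded_measurable_cst _ _ R (a 0))))).
- exact: (int2 _ (bounded_measurable_average bfv)).
move=> v _.
have -> : a v - a 0 = \int[m1]_x (f (x, v) - f (x, 0)).
  by rewrite RintegralB//; exact: (bounded_measurable_integrable m1 (bounded_measurable_x _ bf)).
apply: sqr_Rintegral_le.
by apply: bounded_measurableB; exact: bounded_measurable_x bf.
Qed.

Lemma test_bounded_measurable f : test_function L f -> bounded_measurable f.
Proof.
by move=> tf; split; [exact: test_measurable tf|exact: (test_bounded L_gt0 tf)].
Qed.

Let arith (A M B C X Y l : R) : A <= M + B + C -> C <= 4 * l * X ->
  B <= 16 * Y -> 0 <= X -> 0 <= Y -> 0 <= l -> A - M <= (4 * l + 16) * (X + Y).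
Proof. by move=> *; nra. Qed.

(** The one-dimensional inequalities hold on each slice; their constants 4 L^2 and 16 are added,
    which is simpler than taking the maximum. *)
Lemma phase_poincare f : test_function L f ->
  ip L_gt0 f f - mean L_gt0 f ^+ 2 <=
  (4 * L ^+ 2 + 16) * (ip L_gt0 (dx f) (dx f) + ip L_gt0 (dv f) (dv f)).
Proof.
move=> tf; have sf := test_smooth tf; have bf := test_bounded_measurable tf.
have tx := test_partial true tf; have tv := test_partial false tf.
have bx := test_bounded_measurable tx; have bv := test_bounded_measurable tv.
have [mf [M fM]] := bf.
have b1 : bounded_measurable (fun z : R * R => f (0, z.2)).
  split; last by exists M.
  have m1' : measurable_fun setT (fun v => f (0, v)).
    by apply: (measurableT_comp mf); exact: measurable_pair1.
  exact: (measurableT_comp m1' measurable_snd).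
have b2 : bounded_measurable (fun z : R * R => f (z.1, 0)).
  split; last by exists M.
  have m1' : measurable_fun setT (fun x => f (x, 0)).
    by apply: (measurableT_comp mf); exact: measurable_pair2.
  exact: (measurableT_comp m1' measurable_fst).
have bfx := bounded_measurable_sqr (bounded_measurableB bf b1).
have bfv := bounded_measurable_sqr (bounded_measurableB bf b2).
have mE h : bounded_measurable h -> measurable_fun setT (fun z : R * R => (h z)%:E).
  by move=> [mh _]; apply/measurable_EFinP.
have sq0 h (z : R * R) : (0 <= (h z ^+ 2)%:E)%E by rewrite lee_fin sqr_ge0.
have fin h : bounded_measurable h -> (\int[m]_z (h z)%:E)%E \is a fin_num.
  by move=> bh; apply: integrable_fin_num => //; exact: bounded_measurable_integrable.
have toR h k C : bounded_measurable h -> bounded_measurable k ->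
    (\int[m]_z (h z)%:E <= C%:E * \int[m]_z (k z)%:E)%E ->
    \int[m]_z h z <= C * \int[m]_z k z.
  move=> bh bk; rewrite -(fineK (fin _ bh)) -(fineK (fin _ bk)).
  by rewrite -EFinM lee_fin.
have bx2 := bounded_measurable_sqr bx; have bv2 := bounded_measurable_sqr bv.
have iE h : bounded_measurable h -> m.-integrable setT (EFin \o h).
  by move=> bh; exact: bounded_measurable_integrable.
have mG h : bounded_measurable h ->
    measurable_fun setT (fubini_G m1 (fun z : R * R => (h z)%:E)).
  by move=> /iE ih; exact: measurable_fubini_G ih.
have mF h : bounded_measurable h ->
    measurable_fun setT (fubini_F m2 (fun z : R * R => (h z)%:E)).
  by move=> /iE ih; exact: measurable_fubini_F ih.
have le1 : \int[m]_z (f z - f (0, z.2)) ^+ 2 <=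
    (4 * L ^+ 2) * \int[m]_z (dx f z ^+ 2).
  apply: (toR _ _ _ bfx bx2); rewrite !fubini_tonelli2//; try exact: mE; try exact: sq0.
  rewrite -ge0_integralZl//.
  - apply: ge0_le_integral => //.
    + by move=> v _; apply: integral_ge0 => x _ /=; rewrite lee_fin sqr_ge0.
    + exact: mG bfx.
    + by apply: emeasurable_funM => //; exact: mG bx2.
    + move=> v _; apply: (torus_poincare_at0 (fun x => dx_is_derive x v sf)).
      exact: (everywhere_derivable_continuous (fun x =>
        dx_is_derive x v (test_smooth tx))).
  - exact: mG bx2.
  - by move=> v _; apply: integral_ge0 => x _ /=; rewrite lee_fin sqr_ge0.
  - by rewrite lee_fin mulr_ge0// sqr_ge0.
have le2 : \int[m]_z (f z - f (z.1, 0)) ^+ 2 <= 16 * \int[m]_z (dv f z ^+ 2).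
  apply: (toR _ _ _ bfv bv2); rewrite !fubini_tonelli1//; try exact: mE; try exact: sq0.
  rewrite -ge0_integralZl//.
  - apply: ge0_le_integral => //.
    + by move=> x _; apply: integral_ge0 => v _ /=; rewrite lee_fin sqr_ge0.
    + exact: mF bfv.
    + by apply: emeasurable_funM => //; exact: mF bv2.
    + move=> x _; apply: (gauss_poincare_at0 (fun v => dv_is_derive x v sf)).
      exact: (everywhere_derivable_continuous (fun v =>
        dv_is_derive x v (test_smooth tv))).
  - exact: mF bv2.
  - by move=> x _; apply: integral_ge0 => v _ /=; rewrite lee_fin sqr_ge0.
have V := variance_phase_le bf b1 b2.
have ipE h : ip L_gt0 h h = \int[m]_z (h z ^+ 2).
  by apply: eq_Rintegral => z _; rewrite expr2.
rewrite !ipE /mean.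
have ix : 0 <= \int[m]_z (dx f z ^+ 2) by apply: Rintegral_ge0 => z _; exact: sqr_ge0.
have iv : 0 <= \int[m]_z (dv f z ^+ 2) by apply: Rintegral_ge0 => z _; exact: sqr_ge0.
exact: (arith V le1 le2 ix iv (sqr_ge0 L)).
Qed.

End PhasePoincare.

Section FormOperations.
Context {R : realType} {X : set (R * R -> R)}.

Lemma semi_innerD Q Q' : semi_inner X Q -> semi_inner X Q' ->
  semi_inner X (fun f g => Q f g + Q' f g).
Proof.
move=> s s'; split=> [f g Xf Xg|a f g h Xf Xg Xh|f Xf].
- by rewrite (si_sym s)// (si_sym s').
- by rewrite (si_lin s)// (si_lin s')//; ring.
- by rewrite addr_ge0// ?(si_ge0 s)// (si_ge0 s').
Qed.

Lemma semi_innerZ (c : R) Q : 0 <= c -> semi_inner X Q ->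
  semi_inner X (fun f g => c * Q f g).
Proof.
move=> c0 s; split=> [f g Xf Xg|a f g h Xf Xg Xh|f Xf].
- by rewrite (si_sym s).
- by rewrite (si_lin s)//; ring.
- by rewrite mulr_ge0// (si_ge0 s).
Qed.

(** Brings an H^1 solution into L^2, where it can be compared with the L^2 semigroup. *)
Lemma solution_weaken {L : R} {N : (R * R -> R) -> R}
    {X' : set (R * R -> R)} {N' : (R * R -> R) -> R} u g :
  lin_closed X -> (forall phi, test_function L phi -> X phi /\ X (FP phi)) ->
  (forall f, X f -> X' f) -> (forall f, X f -> 0 <= N' f <= N f) ->
  solution (L := L) (X := X) (N := N) u g ->
  solution (L := L) (X := X') (N := N') u g.
Proof.
move=> linX testX XX' NN' s.
have sq (T : Type) (F : set_system T) (FF : Filter F) (a : T -> (R * R -> R)) :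
    (\forall i \near F, X (a i)) -> N (a i) @[i --> F] --> (0 : R) ->
    N' (a i) @[i --> F] --> (0 : R).
  move=> Xa a0; apply/cvgrPdist_le => d d0; near=> i; rewrite sub0r normrN.
  have Xi : X (a i) by near: i.
  have /andP[N0 NN] := NN' _ Xi.
  rewrite ger0_norm//; apply: (le_trans NN).
  by near: i; exact: cvgr_le a0 _ d0.
have mem t (t0 : 0 <= t) := solution_mem s t0.
have Xsub := sub_closed linX.
split=> t t0.
- have [Xu Xg [phi [tphi c1 c2]]] := solution_closure s t0.
  split; [exact: XX'|exact: XX'|exists phi; split=> //].
    by apply: sq => //; apply: nearW => n; apply: Xsub => //; have [] := testX _ (tphi n).
  by apply: sq => //; apply: nearW => n; apply: Xsub => //; have [] := testX _ (tphi n).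
- have [Xu Xg] := mem _ t0; apply: sq (solution_right s t0).
  near=> h; apply: linX => //; apply: Xsub => //.
  have h0 : 0 <= t + h by rewrite addr_ge0//; near: h; exact: nbhs_right_ge.
  by have [] := mem _ h0.
- have [Xu Xg] := mem _ (ltW t0); apply: sq (solution_left s t0).
  near=> h; apply: Xsub => //.
  have h0 : 0 <= t - h by rewrite subr_ge0; near: h; exact: nbhs_right_le.
  by have [] := mem _ h0.
Unshelve. all: by end_near. Qed.

End FormOperations.

(** * Integral identities and coercivity on test functions *)

Section TestInequalities.
Context {R : realType} {L : R} (L_gt0 : 0 < L).
Local Notation V := (R * R -> R).
Implicit Types f g phi : V.
Local Notation m := (phase_measure L_gt0).
Local Notation ip := (ip L_gt0).
Local Notation mean := (mean L_gt0).

Let linL2 := @L2_lin_closed _ _ L_gt0.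

Let test_integrable f : test_function L f -> m.-integrable setT (EFin \o f).
Proof. by move=> tf; exact/L2_integrable/test_L2. Qed.

(** P phi = d_x (v phi) - (d_v - v) d_v phi, and both terms have integral 0. *)
Lemma mean_FP phi : test_function L phi -> mean (FP phi) = 0.
Proof.
move=> tphi; have tv := test_partial false tphi; have tx := test_snd tphi.
(* The factors 0 here and 1 in [h2] are the values of [(~~ b)%:R] in [integral_partial_weight]. *)
pose h1 z := partial true (fun z => z.2 * phi z) z - 0 * (z.2 * (z.2 * phi z)).
pose h2 z := partial false (dv phi) z - 1 * (z.2 * dv phi z).
have t1 : test_function L h1.
  by apply: testD; [exact: (test_partial true tx)|exact/testN/testZ/test_snd].
have t2 : test_function L h2.
  by apply: testD; [exact: (test_partial false tv)|exact/testN/testZ/test_snd].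
have E : FP phi = fun z => h1 z - h2 z.
  rewrite /h1 (partialMs true (@smooth_snd R) (test_smooth tphi)) partial_snd.
  by apply/funext => z; rewrite /h2 /FP /partial /=; ring.
rewrite /mean E RintegralB//; [|exact: test_integrable..].
by rewrite [X in X - _](integral_partial_weight L_gt0 true tx)
  [X in _ - X](integral_partial_weight L_gt0 false tv) subrr.
Qed.

(** phi P phi = (d_v phi)^2 + d_x (v phi^2 / 2) - (d_v - v)(phi d_v phi), whose integral is |d_v
    phi|^2. *)
Lemma ip_FP_ge0 phi : test_function L phi -> 0 <= ip phi (FP phi).
Proof.
move=> tphi; have tv := test_partial false tphi; have tx := test_partial true tphi.
have sphi := test_smooth tphi; have sv := test_smooth tv.
have t1 := test_snd (testZ 2^-1 (testMM tphi tphi)).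
have t2 := testMM tphi tv.
have sq0 : 0 <= \int[m]_z (dv phi z * dv phi z).
  by apply: Rintegral_ge0 => z _; rewrite -expr2 sqr_ge0.
pose h1 z := partial true (fun z => z.2 * (2^-1 * (phi z * phi z))) z
  - 0 * (z.2 * (z.2 * (2^-1 * (phi z * phi z)))).
pose h2 z := partial false (fun z => phi z * dv phi z) z
  - 1 * (z.2 * (phi z * dv phi z)).
have t1' : test_function L h1.
  by apply: testD; [exact: (test_partial true t1)|exact/testN/testZ/test_snd].
have t2' : test_function L h2.
  by apply: testD; [exact: (test_partial false t2)|exact/testN/testZ/test_snd].
have t3 : test_function L (fun z => h1 z - h2 z) by apply: testD => //; exact: testN.
suff -> : ip phi (FP phi) = \int[m]_z (dv phi z * dv phi z).
  exact: sq0.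
have -> : ip phi (FP phi) =
    \int[m]_z (dv phi z * dv phi z + (h1 z - h2 z)).
  apply: eq_Rintegral => z _.
  rewrite /h1 (partialMs true (@smooth_snd R) (test_smooth (testZ 2^-1 (testMM tphi tphi)))).
  rewrite partial_snd (partialMs true (smooth_cst 2^-1) (smoothM sphi sphi)).
  rewrite partial_cst (partialMs true sphi sphi).
  rewrite /h2 (partialMs false sphi sv) /partial /FP.
  move: (phi z) (dx phi z) (dv phi z) (dv (dv phi) z) => a b c d.
  by rewrite /=; field.
rewrite RintegralD//; [|exact: test_integrable (testMM tv tv)|exact: test_integrable t3].
rewrite RintegralB//; [|exact: test_integrable t1'|exact: test_integrable t2'].
by rewrite [X in _ + (X - _)](integral_partial_weight L_gt0 true t1)
  [X in _ + (_ - X)](integral_partial_weight L_gt0 false t2) subrr addr0.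
Qed.

Lemma energy_coercive phi : test_function L phi ->
  (ip (dx phi) (dx phi) + ip (dv phi) (dv phi)) / 2 <=
  \int[m]_z energy_density phi (FP phi) z.
Proof.
move=> tphi; have tx := test_partial true tphi; have tv := test_partial false tphi.
have tP := test_FP tphi.
have tPx := test_partial true tP; have tPv := test_partial false tP.
have [W [G1 [G2 [tG1 tG2 E Wge]]]] := energy_identity tphi.
pose h1 z := partial true G1 z - 0 * (z.2 * G1 z).
pose h2 z := partial false G2 z - 1 * (z.2 * G2 z).
have t1 : test_function L h1.
  by apply: testD; [exact: (test_partial true tG1)|exact/testN/testZ/test_snd].
have t2 : test_function L h2.
  by apply: testD; [exact: (test_partial false tG2)|exact/testN/testZ/test_snd].
have tE : test_function L (energy_density phi (FP phi)).
  exact: (testD (testD (testD (testZ 10 (testMM tphi tP)) (testZ 2 (testMM tv tPv)))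
    (testD (testMM tx tPv) (testMM tv tPx))) (testMM tx tPx)).
(* [energy_identity] does not say that its [W] is a test function; the identity itself shows it. *)
have tW : test_function L W.
  rewrite (_ : W = fun z => energy_density phi (FP phi) z - (h1 z - h2 z)).
    exact: (testD tE (testN (testD t1 (testN t2)))).
  by apply/funext => z; rewrite E /h1 /h2 /partial; ring.
have -> : \int[m]_z energy_density phi (FP phi) z = \int[m]_z W z.
  have -> : \int[m]_z energy_density phi (FP phi) z = \int[m]_z (W z + (h1 z - h2 z)).
    by apply: eq_Rintegral => z _; rewrite E /h1 /h2 /partial; ring.
  rewrite RintegralD//; [|exact: test_integrable|exact: test_integrable (testD t1 (testN t2))].
  rewrite RintegralB//; [|exact: test_integrable t1|exact: test_integrable t2].
  by rewrite [X in _ + (X - _)](integral_partial_weight L_gt0 true tG1)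
    [X in _ + (_ - X)](integral_partial_weight L_gt0 false tG2) subrr addr0.
have tx2 := testMM tx tx; have tv2 := testMM tv tv.
rewrite /ip -RintegralD//; [|exact: test_integrable tx2|exact: test_integrable tv2].
rewrite -RintegralZr//; last exact: test_integrable (testD tx2 tv2).
apply: le_Rintegral => //; [|exact: test_integrable|].
  have := test_integrable (testZ 2^-1 (testD tx2 tv2)).
  by congr (integrable _ _ _); apply/funext => z /=; rewrite mulrC.
by move=> z _; rewrite -!expr2; exact: Wge.
Qed.

Lemma ip_energy phi g : test_function L phi -> test_function L g ->
  \int[m]_z energy_density phi g z =
  10 * ip phi g + ip (dv phi) (dv g)
  + ip (lin 1 (dx phi) (dv phi)) (lin 1 (dx g) (dv g)).
Proof.
move=> tphi tg.
have p2 := test_L2 L_gt0 tphi; have g2 := test_L2 L_gt0 tg.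
have px2 := test_L2 L_gt0 (test_partial true tphi).
have pv2 := test_L2 L_gt0 (test_partial false tphi).
have gx2 := test_L2 L_gt0 (test_partial true tg).
have gv2 := test_L2 L_gt0 (test_partial false tg).
have l1 := linL2 1 px2 pv2; have l2 := linL2 1 gx2 gv2.
have i1 : m.-integrable setT (EFin \o (fun z => 10 * (phi z * g z))).
  by have := integrableZl measurableT 10 (L2_mul_integrable p2 g2).
have i2 := L2_mul_integrable pv2 gv2; have i3 := L2_mul_integrable l1 l2.
have i12 : m.-integrable setT (EFin \o (fun z => 10 * (phi z * g z) + dv phi z * dv g z)).
  by have := integrableD measurableT i1 i2.
rewrite /ip -RintegralZl//; last exact: L2_mul_integrable.
rewrite -RintegralD// -RintegralD//.
by apply: eq_Rintegral => z _; rewrite /energy_density /lin /partial; ring.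
Qed.

End TestInequalities.

(* 4 L^2 + 16 is the constant C of the Poincare inequality of dmu dnu, and
   E <= (10 C + 3) (|d_x f|^2 + |d_v f|^2). *)
Definition decay_rate {R : realType} (L : R) : R :=
  (2 * (10 * (4 * L ^+ 2 + 16) + 3))^-1.

(** * The H^1 norm and the modified energy as forms *)

Section Decay.
Context {R : realType} {L : R} (L_gt0 : 0 < L).
Local Notation V := (R * R -> R).
Implicit Types f g h phi psi : V.
Local Notation m := (phase_measure L_gt0).
Local Notation ip := (ip L_gt0).
Local Notation L2 := (L2 L_gt0).
Local Notation H1 := (H1 L_gt0).
Local Notation nL2 := (L2norm L_gt0).
Local Notation nH1 := (H1norm L_gt0).
Local Notation mean := (mean L_gt0).
Local Notation L2eq := (L2eq L_gt0).

Let linL2 := @L2_lin_closed _ _ L_gt0.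
Let siL2 := @ip_semi_inner _ _ L_gt0.
Let linH1 := @H1_lin_closed _ _ L_gt0.

Let H1_L2 f : H1 f -> L2 f. Proof. by case. Qed.

Lemma L2_cst (c : R) : L2 (fun=> c).
Proof. by apply: (@bounded_L2 _ _ L_gt0 _ `|c|) => //; exact: measurable_cst. Qed.

Lemma meanE f : mean f = ip f (fun=> 1).
Proof. by apply: eq_Rintegral => z _; rewrite mulr1. Qed.

Lemma mean_lin a f g : L2 f -> L2 g -> mean (lin a f g) = a * mean f + mean g.
Proof. by move=> f2 g2; rewrite !meanE (si_lin siL2)//; exact: L2_cst. Qed.

Lemma ip_cst (a b : R) : ip (fun=> a) (fun=> b) = a * b.
Proof. exact: (Rintegral_prob_cst m). Qed.

Definition centered f : V := lin (- mean f) (fun=> 1) f.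

Lemma centered_L2 f : L2 f -> L2 (centered f).
Proof. by move=> f2; apply: linL2 => //; exact: L2_cst. Qed.

Lemma ip_centered f g : L2 f -> L2 g ->
  ip (centered f) (centered g) = ip f g - mean f * mean g.
Proof.
move=> f2 g2; have c1 := L2_cst 1.
rewrite /centered (si_lin siL2)//; last exact: linL2.
rewrite !(si_linr linL2 siL2)// ip_cst -meanE (si_sym siL2 c1)// -meanE.
by ring.
Qed.

Let L2eq_refl f g : L2 f -> f = g -> L2eq f g.
Proof.
move=> f2 <-; split=> //; rewrite L2normE; last exact: (sub_closed linL2 f2 f2).
rewrite /snorm (si_subl siL2)//; last exact: (sub_closed linL2 f2 f2).
by rewrite subrr sqrtr0.
Qed.

(** The product of the means, written as a pullback so that [pullback_semi_inner] applies. *)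
Definition mean_form := pullback L_gt0 (fun f : V => ((fun=> mean f) : V)).

Lemma mean_formE f g : mean_form f g = mean f * mean g.
Proof. exact: ip_cst. Qed.

Lemma mean_form_semi_inner : semi_inner H1 mean_form.
Proof.
apply: pullback_semi_inner => [f _|a f g f1 g1]; first exact: L2_cst.
apply: L2eq_refl; first exact: L2_cst.
by apply/funext => z; rewrite /lin mean_lin//; exact: H1_L2.
Qed.

Let semi_inner_ip_H1 : semi_inner H1 ip.
Proof.
by split=> *; [apply: (si_sym siL2)|apply: (si_lin siL2)|apply: (si_ge0 siL2)];
  exact: H1_L2.
Qed.

Let nL2_sqr f : L2 f -> nL2 f ^+ 2 = ip f f.
Proof. by move=> f2; rewrite L2normE// sqr_sqrtr// (si_ge0 siL2). Qed.

Let sum_sqr x v (c : R) : L2 x -> L2 v -> ip (lin c x v) (lin c x v) =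
  c ^+ 2 * ip x x + 2 * c * ip x v + ip v v.
Proof. by move=> x2 v2; rewrite (si_sqr_lin linL2 siL2)//; ring. Qed.

Let sum_ge0 x v (c : R) : L2 x -> L2 v ->
  0 <= c ^+ 2 * ip x x + 2 * c * ip x v + ip v v.
Proof. by move=> x2 v2; rewrite -sum_sqr//; apply: (si_ge0 siL2); exact: linL2. Qed.

Lemma energy_upper f x v : L2 f -> L2 x -> L2 v ->
  10 * ip (centered f) (centered f) + (ip v v + ip (lin 1 x v) (lin 1 x v)) <=
  10 * (ip f f + (ip x x + ip v v)).
Proof.
move=> f2 x2 v2; rewrite ip_centered// sum_sqr// -expr2.
have := sum_ge0 (-1) x2 v2; have := sqr_ge0 (mean f).
have := si_ge0 siL2 x2; have := si_ge0 siL2 v2.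
move: (ip x x) (ip x v) (ip v v) (ip f f) (mean f ^+ 2) => A B C D M; lra.
Qed.

(** The mean form gives back what centring removes from |f|^2, so that the bound holds for every
    mean. *)
Lemma energy_lower f x v : L2 f -> L2 x -> L2 v ->
  ip f f + (ip x x + ip v v) <=
  3 * (10 * ip (centered f) (centered f) + (ip v v + ip (lin 1 x v) (lin 1 x v))
       + 10 * mean_form f f).
Proof.
move=> f2 x2 v2; rewrite ip_centered// sum_sqr// mean_formE -expr2.
(* The two sides differ by 29 D + 2 A + 6 B + 5 C, and 9/2 times this square is 2 A + 6 B + 9 C / 2,
   which absorbs the cross term. *)
have := sum_ge0 (2 / 3) x2 v2; have := si_ge0 siL2 f2.
have := si_ge0 siL2 x2; have := si_ge0 siL2 v2.
move: (ip x x) (ip x v) (ip v v) (ip f f) (mean f ^+ 2) => A B C D M.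
lra.
Qed.

Section Dense.
Context (dense : forall f (e : R), L2 f -> 0 < e ->
  exists2 psi, test_function L psi & nL2 (psi \- f) < e).

Local Notation grad b := (gradient L_gt0 b).

Definition sum_gradient f : V := lin 1 (grad true f) (grad false f).

Lemma sum_gradient_L2 f : H1 f -> L2 (sum_gradient f).
Proof. by move=> f1; apply: linL2; exact: gradient_L2. Qed.

Let L2eq_lin a f f' g g' : L2eq f f' -> L2eq g g' -> L2eq (lin a f g) (lin a f' g').
Proof.
move=> [f2 f'2 ff'] [g2 g'2 gg']; split; [exact: linL2|exact: linL2|].
exact: (N_eq_lin linL2 siL2 (@L2normE _ _ L_gt0)).
Qed.

Let L2eq_trans f g h : L2eq f g -> L2eq g h -> L2eq f h.
Proof.
move=> [f2 g2 fg] [_ h2 gh]; split=> //.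
exact: (N_eq_trans linL2 siL2 (@L2normE _ _ L_gt0) f2 g2 h2).
Qed.

Lemma sum_gradient_lin a f g : H1 f -> H1 g ->
  L2eq (sum_gradient (lin a f g)) (lin a (sum_gradient f) (sum_gradient g)).
Proof.
move=> f1 g1.
apply: (L2eq_trans (L2eq_lin 1 (gradient_lin dense true a f1 g1)
  (gradient_lin dense false a f1 g1))).
apply: L2eq_refl.
  exact: (linL2 1 (linL2 a (gradient_L2 true f1) (gradient_L2 true g1))
    (linL2 a (gradient_L2 false f1) (gradient_L2 false g1))).
apply/funext => z; rewrite /sum_gradient /lin.
move: (grad true f z) (grad false f z) (grad true g z) (grad false g z) => p q r s.
by ring.
Qed.

Definition H1_form f g := ip f g + (pullback L_gt0 (grad true) f g
  + pullback L_gt0 (grad false) f g).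

Let semi_inner_grad b : semi_inner H1 (pullback L_gt0 (grad b)).
Proof.
apply: pullback_semi_inner => [f f1|a f g f1 g1]; first exact: gradient_L2.
exact: gradient_lin.
Qed.

Let semi_inner_sum : semi_inner H1 (pullback L_gt0 sum_gradient).
Proof.
apply: pullback_semi_inner => [f f1|a f g f1 g1]; first exact: sum_gradient_L2.
exact: sum_gradient_lin.
Qed.

Lemma H1_form_semi_inner : semi_inner H1 H1_form.
Proof.
exact: (semi_innerD semi_inner_ip_H1 (semi_innerD (semi_inner_grad true) (semi_inner_grad false))).
Qed.

Lemma H1normE f : H1 f -> nH1 f = snorm H1_form f.
Proof.
move=> f1; have e0 := nL2_sqr (H1_L2 f1).
have e1 := nL2_sqr (gradient_L2 true f1); have e2 := nL2_sqr (gradient_L2 false f1).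
have -> : nH1 f = Num.sqrt (nL2 f ^+ 2 + nL2 (grad true f) ^+ 2 + nL2 (grad false f) ^+ 2).
  exact: erefl.
exact: (etrans (f_equal Num.sqrt (f_equal2 +%R (f_equal2 +%R e0 e1) e2))
  (f_equal Num.sqrt (esym (addrA _ _ _)))).
Qed.

Definition energy_form f g := 10 * pullback L_gt0 centered f g +
  (pullback L_gt0 (grad false) f g + pullback L_gt0 sum_gradient f g).

Lemma energy_form_semi_inner : semi_inner H1 energy_form.
Proof.
have sc : semi_inner H1 (pullback L_gt0 centered).
  apply: pullback_semi_inner => [f f1|a f g f1 g1]; first exact/centered_L2/H1_L2.
  apply: L2eq_refl; first exact/centered_L2/H1_L2/linH1.
  apply/funext => z; rewrite /centered mean_lin; [|exact: H1_L2..].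
  by rewrite /lin; ring.
exact: (semi_innerD (semi_innerZ (ler0n R 10) sc)
  (semi_innerD (semi_inner_grad false) semi_inner_sum)).
Qed.

Lemma energy_form_le f : H1 f -> energy_form f f <= 10 * H1_form f f.
Proof.
move=> f1.
exact: (energy_upper (H1_L2 f1) (gradient_L2 true f1) (gradient_L2 false f1)).
Qed.

Lemma H1_form_le f : H1 f -> H1_form f f <= 3 * (energy_form f f + 10 * mean_form f f).
Proof.
move=> f1.
exact: (energy_lower (H1_L2 f1) (gradient_L2 true f1) (gradient_L2 false f1)).
Qed.

Lemma mean_form_le f : H1 f -> mean_form f f <= H1_form f f.
Proof.
move=> f1; have f2 := H1_L2 f1.
have le1 : mean_form f f <= ip f f.
  by rewrite mean_formE -subr_ge0 -ip_centered//; apply: (si_ge0 siL2); exact: centered_L2.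
apply: (le_trans le1); rewrite lerDl.
exact: (addr_ge0 (si_ge0 (semi_inner_grad true) f1) (si_ge0 (semi_inner_grad false) f1)).
Qed.

Local Notation kappa := (decay_rate L).

Lemma decay_rate_gt0 : 0 < kappa.
Proof. by rewrite /decay_rate invr_gt0; have := sqr_ge0 L; lra. Qed.

Let L2eq_sum_test phi : test_function L phi ->
  L2eq (sum_gradient phi) (lin 1 (dx phi) (dv phi)).
Proof.
by move=> tphi; apply: L2eq_lin; exact: gradient_test.
Qed.

(** By [mean_FP] the mean term drops out of the right-hand side, so [energy_coercive] applies
    whatever the mean of phi; Poincare's inequality then bounds the energy by the gradient. *)
Lemma energy_form_test phi : test_function L phi ->
  kappa * energy_form phi phi <= energy_form phi (FP phi).
Proof.
move=> tphi; have tP := test_FP tphi.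
have p2 := test_L2 L_gt0 tphi; have P2 := test_L2 L_gt0 tP.
have E g : test_function L g -> energy_form phi g =
    10 * (ip phi g - mean phi * mean g) + (ip (dv phi) (dv g) +
      ip (lin 1 (dx phi) (dv phi)) (lin 1 (dx g) (dv g))).
  move=> tg; rewrite /energy_form /pullback ip_centered//; last exact: test_L2.
  rewrite (ip_L2eq2 (gradient_test dense false tphi) (gradient_test dense false tg)).
  by rewrite (ip_L2eq2 (L2eq_sum_test tphi) (L2eq_sum_test tg)).
have px2 : L2 (dx phi) := test_L2 L_gt0 (test_partial true tphi).
have pv2 : L2 (dv phi) := test_L2 L_gt0 (test_partial false tphi).
have -> : energy_form phi (FP phi) = \int[m]_z energy_density phi (FP phi) z.
  by rewrite E// mean_FP// mulr0 subr0 ip_energy// addrA.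
apply: le_trans (energy_coercive L_gt0 tphi).
rewrite (E _ tphi) (si_sqr_lin linL2 siL2 1 px2 pv2) -expr2.
have P := phase_poincare L_gt0 tphi.
(* |d_v phi - d_x phi|^2 >= 0 controls the cross term of |d_x phi + d_v phi|^2. *)
have Y := si_ge0 siL2 (linL2 (-1) px2 pv2); move: Y P.
rewrite (si_sqr_lin linL2 siL2 (-1) px2 pv2).
have := si_ge0 siL2 px2; have := si_ge0 siL2 pv2.
rewrite /decay_rate; have := sqr_ge0 L; move: (L ^+ 2) => l.
move: (ip (dx phi) (dx phi)) (ip (dx phi) (dv phi)) (ip (dv phi) (dv phi)).
move: (ip phi phi - mean phi ^+ 2) => D A C B l0 B0 A0 Y P.
rewrite mulrC ler_pdivrMr; last by lra.
by nra.
Qed.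

End Dense.
End Decay.

(** * From the H^1 semigroup to the L^2 semigroup *)

Section Transfer.
Context {R : realType} {L : R} (L_gt0 : 0 < L).
Local Notation V := (R * R -> R).
Implicit Types f g phi psi : V.
Local Notation ip := (ip L_gt0).
Local Notation L2 := (L2 L_gt0).
Local Notation H1 := (H1 L_gt0).
Local Notation nL2 := (L2norm L_gt0).
Local Notation nH1 := (H1norm L_gt0).
Local Notation mean := (mean L_gt0).
Local Notation L2eq := (L2eq L_gt0).
Local Notation H1_form := (H1_form L_gt0).
Local Notation energy_form := (energy_form L_gt0).
Local Notation mean_form := (mean_form L_gt0).

Let linL2 := @L2_lin_closed _ _ L_gt0.
Let siL2 := @ip_semi_inner _ _ L_gt0.
Let linH1 := @H1_lin_closed _ _ L_gt0.
Let L2E := @L2normE _ _ L_gt0.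
Let H1E := @H1normE _ _ L_gt0.

Let H1_L2 f : H1 f -> L2 f. Proof. by case. Qed.

Context {T S : R -> V -> V}.
Context (FPT : FP_semigroup L H1 nH1 T) (FPS : FP_semigroup L L2 nL2 S).

Let dense := FP_semigroup_dense FPS.
Let siH1 := H1_form_semi_inner dense.

Let testL2 phi : test_function L phi -> L2 phi /\ L2 (FP phi).
Proof. by move=> tphi; split; apply: test_L2 => //; exact: test_FP. Qed.

Let testH1 phi : test_function L phi -> H1 phi /\ H1 (FP phi).
Proof. by move=> tphi; split; apply: test_H1 => //; exact: test_FP. Qed.

Lemma ip_le_H1_form f : H1 f -> ip f f <= H1_form f f.
Proof.
move=> f1; rewrite lerDl; apply: addr_ge0; apply: (si_ge0 siL2); exact: gradient_L2.
Qed.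

Lemma L2norm_le_H1norm f : H1 f -> 0 <= nL2 f <= nH1 f.
Proof.
move=> f1; rewrite (N_ge0 L2E (H1_L2 f1)) /= (L2E (H1_L2 f1)) (H1E f1).
by rewrite ler_wsqrtr// ip_le_H1_form.
Qed.

Let L2norm_eq0 f : H1 f -> nH1 f = 0 -> nL2 f = 0.
Proof.
by move=> f1 f0; apply/eqP; rewrite eq_le andbC; have := L2norm_le_H1norm f1; rewrite f0.
Qed.

(** The difference is a solution in L^2 that starts from a null function, and [ip_FP_ge0] is the
    coercivity hypothesis of [solution_decay] with k = 0. *)
Lemma semigroups_agree_test phi (t : R) : test_function L phi -> 0 <= t ->
  nL2 (T t phi \- S t phi) = 0.
Proof.
move=> tphi t0.
have s1 := solution_weaken linH1 testH1 H1_L2 L2norm_le_H1norm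
  (semigroup_solution linH1 siH1 H1E testH1 FPT tphi).
have s2 := semigroup_solution linL2 siL2 L2E testL2 FPS tphi.
have sd := solution_sub linL2 siL2 L2E testL2 (@test_sub R L) s1 s2.
have QN f : L2 f -> snorm ip f <= 1 * nL2 f by move=> f2; rewrite mul1r (L2E f2).
have Qtest psi : test_function L psi -> 0 * ip psi psi <= ip psi (FP psi).
  by move=> tpsi; rewrite mul0r; exact: ip_FP_ge0.
have [p1 _] := testH1 tphi; have p2 := H1_L2 p1.
have T1 (s : R) : 0 <= s -> H1 (T s phi).
  by move=> s0; exact: (semigroup_stable (FP_semigroup_C0 FPT)).
have S2 (s : R) : 0 <= s -> L2 (S s phi).
  by move=> s0; exact: (semigroup_stable (FP_semigroup_C0 FPS)).
have w2 (s : R) : 0 <= s -> L2 (T s phi \- S s phi).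
  by move=> s0; exact: (sub_closed linL2 (H1_L2 (T1 s s0)) (S2 s s0)).
have w0 : nL2 (T 0 phi \- S 0 phi) = 0.
  apply: (N_eq_trans linL2 siL2 L2E (H1_L2 (T1 0 (lexx 0))) p2 (S2 0 (lexx 0))).
    apply: L2norm_eq0; first exact: (sub_closed linH1 (T1 0 (lexx 0)) p1).
    exact: (semigroup_0 (FP_semigroup_C0 FPT) p1).
  rewrite (N_subC linL2 siL2 L2E p2 (S2 0 (lexx 0))).
  exact: (semigroup_0 (FP_semigroup_C0 FPS) p2).
have q0 : ip (T 0 phi \- S 0 phi) (T 0 phi \- S 0 phi) = 0.
  exact: (ip_eq0 (w2 0 (lexx 0)) (w2 0 (lexx 0)) w0).
have := solution_decay linL2 siL2 L2E testL2 siL2 QN Qtest sd t0.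
rewrite q0 mulr0 => le0.
rewrite (L2E (w2 t t0)); exact: ler0_sqrtr.
Qed.

(** Test functions approximate f in H^1, hence also in L^2, and each semigroup is continuous in its
    own norm. *)
Lemma semigroups_agree f (t : R) : H1 f -> 0 <= t -> L2eq (T t f) (S t f).
Proof.
move=> f1 t0; have f2 := H1_L2 f1.
have T1 g : H1 g -> H1 (T t g).
  by move=> g1; exact: (semigroup_stable (FP_semigroup_C0 FPT)).
have S2 g : L2 g -> L2 (S t g).
  by move=> g2; exact: (semigroup_stable (FP_semigroup_C0 FPS)).
split; [exact: H1_L2 (T1 _ f1)|exact: S2 _ f2|].
have [phi [tphi cphi]] := test_dense linH1 H1E testH1 FPT f1.
have phi1 n : H1 (phi n) by have [] := testH1 (tphi n).
have phi2 n := H1_L2 (phi1 n).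
have weaken (a : nat -> V) : (forall n, H1 (a n)) -> nH1 (a n) @[n --> \oo] --> (0 : R) ->
    nL2 (a n) @[n --> \oo] --> (0 : R).
  move=> a1; apply: (squeeze_cvgr _ (cvg_cst 0)); apply: nearW => n.
  exact: L2norm_le_H1norm.
have c1 := weaken _ (fun n => sub_closed linH1 (T1 _ (phi1 n)) (T1 _ f1))
  (semigroup_cvg linH1 siH1 H1E FPT t0 phi1 f1 cphi).
have c2 := semigroup_cvg linL2 siL2 L2E FPS t0 phi2 f2
  (weaken _ (fun n => sub_closed linH1 (phi1 n) f1) cphi).
have D2 : L2 (T t f \- S t f) by exact: (sub_closed linL2 (H1_L2 (T1 _ f1)) (S2 _ f2)).
apply/eqP; rewrite eq_le (N_ge0 L2E D2) andbT.
have cD : nL2 (T t (phi n) \- T t f) + nL2 (S t (phi n) \- S t f) @[n --> \oo] -->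
    (0 : R) by rewrite -[X in _ --> X](addr0 0); exact: cvgD.
have cC : (fun _ : nat => nL2 (T t f \- S t f)) @ \oo --> nL2 (T t f \- S t f).
  exact: cvg_cst.
apply: (ler_cvg_to cC cD); apply: nearW => n.
have Tf := H1_L2 (T1 _ f1); have Tn := H1_L2 (T1 _ (phi1 n)).
have Sf := S2 _ f2; have Sn := S2 _ (phi2 n).
apply: (le_trans (N_triangle linL2 siL2 L2E Tf Tn Sf)).
rewrite (N_subC linL2 siL2 L2E Tf Tn); apply: lerD => //.
apply: (le_trans (N_triangle linL2 siL2 L2E Tn Sn Sf)).
by rewrite (semigroups_agree_test (tphi n) t0) add0r.
Qed.

(** The duality of [weak_derivativeP] sees only the class of f, so f and g have the same weak
    derivatives. *)
Lemma H1norm_L2eq f g : H1 f -> L2eq f g -> H1 g /\ nH1 g = nH1 f.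
Proof.
move=> f1 fg; have [f2 g2 _] := fg.
have dg b : L2_derivatives L_gt0 (partial b) g (gradient L_gt0 b f).
  have [x2 xP] := gradientP b f1; split=> //.
  apply/(weak_derivativeP b g2 x2) => psi tpsi.
  rewrite -((weak_derivativeP b f2 x2).1 xP psi tpsi).
  by rewrite (ip_L2eq fg (test_L2 L_gt0 (test_adjoint b tpsi))).
have g1 : H1 g by apply/H1P; split=> // b; exists (gradient L_gt0 b f); exact: dg.
split; first exact: g1.
have e b := gradient_eq dense (dg b) g1.
have E : H1_form g g = H1_form f f.
  exact: (f_equal2 +%R (esym (ip_L2eq2 fg fg))
    (f_equal2 +%R (ip_L2eq2 (e true) (e true)) (ip_L2eq2 (e false) (e false)))).
exact: (etrans (H1E g1) (etrans (f_equal Num.sqrt E) (esym (H1E f1)))).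
Qed.

(** The energy decays at the rate 2 [decay_rate L], and the squared mean, decaying at rate 0, stays
    0. The equivalence constants 10 and 3 give 30 for squared norms, rounded up to 36 = 6^2. *)
Lemma H1_decay f (t : R) : H1 f -> mean f = 0 -> 0 <= t ->
  nH1 (T t f) <= 6 * expR (- (decay_rate L * t)) * nH1 f.
Proof.
move=> f1 mf t0.
have T1 : H1 (T t f) by exact: (semigroup_stable (FP_semigroup_C0 FPT)).
have EN g : H1 g -> snorm energy_form g <= Num.sqrt 10 * nH1 g.
  by move=> g1; rewrite (H1E g1) -sqrtrM// ler_wsqrtr// energy_form_le.
have MN g : H1 g -> snorm mean_form g <= 1 * nH1 g.
  by move=> g1; rewrite mul1r (H1E g1) ler_wsqrtr//; exact: (mean_form_le dense).
have Mtest psi : test_function L psi -> 0 * mean_form psi psi <= mean_form psi (FP psi).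
  by move=> tpsi; rewrite mul0r mean_formE mean_FP// mulr0.
have e1 := semigroup_decay linH1 siH1 H1E testH1 FPT (energy_form_semi_inner dense)
  EN (energy_form_test dense) f1 t0.
have e2 := semigroup_decay linH1 siH1 H1E testH1 FPT (mean_form_semi_inner L_gt0)
  MN Mtest f1 t0.
have m0 : mean_form f f = 0 by rewrite mean_formE mf mulr0.
rewrite m0 mulr0 in e2.
have e3 := H1_form_le T1; have e4 := energy_form_le f1; have e5 := si_ge0 siH1 f1.
rewrite (H1E T1) (H1E f1) /snorm.
have E : expR (- (2 * decay_rate L) * t) = expR (- (decay_rate L * t)) ^+ 2.
  by rewrite -expRM_natl; congr expR; ring.
rewrite E in e1.
have c0 : 0 <= 6 * expR (- (decay_rate L * t)) by rewrite mulr_ge0// expR_ge0.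
rewrite -(ger0_norm c0) -sqrtr_sqr -sqrtrM ?sqr_ge0//; apply: ler_wsqrtr.
have p0 := sqr_ge0 (expR (- (decay_rate L * t))).
rewrite exprMn; move: (expR _ ^+ 2) p0 e1 => p p0 e1.
have e6 := ler_wpM2l p0 e4; have e7 := mulr_ge0 p0 e5.
apply: (le_trans e3); apply: (@le_trans _ _ (3 * (p * (10 * H1_form f f)))).
  rewrite ler_pM2l//; apply: le_trans (le_trans e1 e6).
  by rewrite gerDl mulr_ge0_le0.
move: e7; clear; move: (H1_form f f) => A pA.
by rewrite -subr_ge0 (_ : _ - _ = 6 * (p * A)); [exact: mulr_ge0|ring].
Qed.

End Transfer.

Theorem corollary2p3 (R : realType) (L : R) (L_gt0 : 0 < L)
    (H1_well_posed :
      exists T, FP_semigroup L (H1 L_gt0) (H1norm L_gt0) T) :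
  exists c kappa : R, [/\ 0 < c, 0 < kappa &
    forall S, FP_semigroup L (L2 L_gt0) (L2norm L_gt0) S ->
    forall f0, H1 L_gt0 f0 -> mean L_gt0 f0 = 0 ->
    forall t, 0 <= t ->
      H1 L_gt0 (S t f0) /\
      H1norm L_gt0 (S t f0) <= c * expR (- (kappa * t)) * H1norm L_gt0 f0].
Proof.
have [T FPT] := H1_well_posed.
exists 6, (decay_rate L); split=> //; first exact: decay_rate_gt0.
move=> S FPS f0 f1 mf t t0.
have T1 : H1 L_gt0 (T t f0) by exact: (semigroup_stable (FP_semigroup_C0 FPT)).
(* [S t f0] and [T t f0] are possibly different representatives of one class, so membership in H^1
   is transferred together with the norm. *)
have [S1 SE] := H1norm_L2eq FPS T1 (semigroups_agree FPT FPS f1 t0).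
split; first exact: S1.
rewrite SE; exact: (H1_decay FPT FPS f1 mf t0).
Qed.
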